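(* Let $f \in C^{0,1}([0,1]^n)$ with $f>0$ on $[0,1]^n$. For $h>0$ let $v_h:[0,1]^n_h\to\mathbb{R}$ be the maximal solution of the scheme (S2), and let $u$ be the nondecreasing viscosity solution of (P1) (both defined in the context). Then there is a constant $C>0$ depending only on $n$, $[f]_{1;[0,1]^n}$ and $\inf_{[0,1]^n} f$ such that $$|n^n v_h(x) - u(x)^n| \le C\sqrt{h}\quad\text{for all } x\in[0,1]^n_h,$$ and, for every $\delta>0$, $$|n\,v_h(x)^{1/n} - u(x)| \le C\,\delta^{1-n}\sqrt{h}\quad\text{for all } x\in[\delta,1]^n_h.$$
   Context: $n\ge 1$ is an integer, $a_+=\max(a,0)$, and $\Gamma=\partial[0,1]^n\setminus(0,1]^n$ (the points of $[0,1]^n$ with at least one zero coordinate). $[f]_{1;[0,1]^n}$ is the Lipschitz seminorm $\sup_{x\ne y}|f(x)-f(y)|/|x-y|$. A function is nondecreasing if it is nondecreasing in each coordinate $x_i$ separately. Grid: for $h>0$, $\mathbb{Z}_h=\{hk:k\in\mathbb{Z}\}$, $\mathbb{Z}_h^n=(\mathbb{Z}_h)^n$, and $\Omega_h=\Omega\cap\mathbb{Z}_h^n$ for $\Omega\subseteq\mathbb{R}^n$ (so $[0,1]^n_h=[0,1]^n\cap\mathbb{Z}^n_h$, $[\delta,1]^n_h=[\delta,1]^n\cap\mathbb{Z}_h^n$, etc.). $D_i^-g(x)=\dfrac{g(x)-g(x-he_i)}{h}$, where $e_i$ is the $i$-th standard basis vector. Problem (P1): $(u_{x_1})_+\cdots(u_{x_n})_+=f$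 in $(0,1]^n$, $u=0$ on $\Gamma$. A viscosity solution of (P1) is a continuous $u:[0,1]^n\to\mathbb{R}$ with $u=0$ on $\Gamma$ such that for every $x_0\in(0,1]^n$ and every $C^1$ function $\phi$: if $u-\phi$ has a local maximum (resp. minimum) at $x_0$ relative to $(0,1]^n$, then $\prod_i(\phi_{x_i}(x_0))_+\le f(x_0)$ (resp. $\ge f(x_0)$). For continuous nonnegative $f$ there is a unique nondecreasing viscosity solution of (P1). Scheme (S2): $(D_1^-v_h(x))_+\cdots(D_n^-v_h(x))_+=v_h(x)^{n-1}f(x)$ for $x\in(0,1]^n_h$, $v_h(x)=0$ for $x\in\Gamma_h$. The maximal solution $v_h$ is defined inductively: at each $x\in(0,1]^n_h$, given $v_h(x-he_1),\dots,v_h(x-he_n)$, the value $v_h(x)$ is the largest real number satisfying the equation at $x$. *)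

(* Defs.v *)
From HB Require Import structures.
From mathcomp Require Import all_boot all_order all_algebra.
From mathcomp Require Import all_classical all_reals all_analysis.

Set Implicit Arguments.
Unset Strict Implicit.
Unset Printing Implicit Defensive.

Import Order.TTheory GRing.Theory Num.Theory.
Import numFieldNormedType.Exports.

Local Open Scope classical_set_scope.
Local Open Scope ring_scope.

Section Defs.
Context {R : realType} {n : nat}.
Implicit Types (x y : 'rV[R]_n) (f g u v w phi : 'rV[R]_n -> R) (h delta : R).

Definition pos_part (a : R) : R := Num.max a 0.

Definition basis_vec (i : 'I_n) : 'rV[R]_n := delta_mx ord0 i.

(* The library norm on ['rV[R]_n] is the sup norm. *)
Definition euclid_norm x : R := Num.sqrt (\sum_(i < n) x ord0 i ^+ 2).

Definition cube : set 'rV[R]_n := [set x | forall i, 0 <= x ord0 i <= 1].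

Definition pos_cube : set 'rV[R]_n := [set x | forall i, 0 < x ord0 i <= 1].

Definition delta_cube delta : set 'rV[R]_n :=
  [set x | forall i, delta <= x ord0 i <= 1].

Definition Gamma : set 'rV[R]_n :=
  [set x | cube x /\ exists i, x ord0 i = 0].

Definition lipschitz_quotients f : set R :=
  [set r | exists x y, [/\ cube x, cube y, x != y &
                           r = `|f x - f y| / euclid_norm (x - y)]].

Definition lipschitz_on_cube f : Prop := has_ubound (lipschitz_quotients f).

(* The set is nonempty for [0 < n], so this is the true supremum as soon as
   [lipschitz_on_cube f]. *)
Definition lipschitz_seminorm f : R := sup (lipschitz_quotients f).

Definition nondecreasing_on_cube g : Prop :=
  forall x (i : 'I_n) (t : R), 0 <= t -> cube x ->
    cube (x + t *: basis_vec i) -> g x <= g (x + t *: basis_vec i).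

Definition C1 phi : Prop :=
  forall i : 'I_n, (forall x, derivable phi x (basis_vec i)) /\
                   continuous (fun x => 'D_(basis_vec i) phi x).

Definition local_max_rel (A : set 'rV[R]_n) g x0 : Prop :=
  \forall x \near x0, A x -> g x <= g x0.

Definition local_min_rel (A : set 'rV[R]_n) g x0 : Prop :=
  \forall x \near x0, A x -> g x0 <= g x.

Definition viscosity_solution f u : Prop :=
  [/\ {within cube, continuous u},
      (forall x, Gamma x -> u x = 0),
      (forall x0 phi, pos_cube x0 -> C1 phi ->
         local_max_rel pos_cube (fun x => u x - phi x) x0 ->
         \prod_(i < n) pos_part ('D_(basis_vec i) phi x0) <= f x0) &
      (forall x0 phi, pos_cube x0 -> C1 phi ->
         local_min_rel pos_cube (fun x => u x - phi x) x0 ->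
         f x0 <= \prod_(i < n) pos_part ('D_(basis_vec i) phi x0))].

Definition grid h : set 'rV[R]_n :=
  [set x | forall i, exists k : int, x ord0 i = h * k%:~R].

Definition back_diff h (i : 'I_n) g x : R :=
  (g x - g (x - h *: basis_vec i)) / h.

Definition scheme_at h f v x : Prop :=
  \prod_(i < n) pos_part (back_diff h i v x) = v x ^+ n.-1 * f x.

(* The competitors [w] in the maximality clause keep the values of [v] at the
   neighbours of [x], and only their value at [x] is free. Grid functions are
   total, but only their values on [cube `&` grid h] are ever used. *)
Definition maximal_scheme_solution h f v : Prop :=
  (forall x, (Gamma `&` grid h) x -> v x = 0) /\
  (forall x, (pos_cube `&` grid h) x ->
     scheme_at h f v x /\
     forall w,
       (forall i, w (x - h *: basis_vec i) = v (x - h *: basis_vec i)) ->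
       scheme_at h f w x -> w x <= v x).

End Defs.

(* Main.v *)
Require Import Defs.
From HB Require Import structures.
From mathcomp Require Import all_boot all_order all_algebra.
From mathcomp Require Import all_classical all_reals all_analysis.
From mathcomp Require Import ring lra.
Import Order.TTheory GRing.Theory Num.Theory.
Import numFieldNormedType.Exports.
Local Open Scope classical_set_scope.
Local Open Scope ring_scope.

(** Why the theorem is true. The equation of the scheme and the one satisfied by
    [w = (u / n) ^ n], namely [\prod_i w_i = w ^ (n - 1) * f], are solved by [c]
    times the volume function [vol x = \prod_i x_i] when [f] is the constant
    [c], on the grid as well as in the continuum. Dividing by [vol] turns both
    into the form

      [g * \prod_i (1 + x_i * g_i / g) = f],

    where [g_i] is a partial derivative, or a difference quotient with weight
    [x_i - h] ([normalized_prod_slope], [slope_next]). In terms of [ln g] this is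
    an equation that increases strictly in the unknown, and its weight [x_i]
    vanishes on the boundary, where [g] has no prescribed value. All comparisons
    are therefore made between the logarithms of the quotients
    [normalized v = v / vol] and [unormalized u = w / vol].

    Three consequences carry the argument. At extremal points the quotients
    compare with [f], so they lie between positive constants
    ([normalized_bounds], and [u_bounds] for the continuum, where the exact
    solutions for constant right-hand sides serve as barriers). Doubling the
    variables on the grid shows that [ln (normalized v)] is Lipschitz, with a
    constant given by that of [ln f] ([ln_normalized_lipschitz]): for a penalty
    in [x - y] with gradient [p], the difference of the weighted slopes
    [x_i * p_i - y_i * p_i] has the favourable sign.

    Finally the variables are doubled between the grid and the cube, with
    penalty [|x - y|^2 / (2 * r)], [r = sqrt h] ([penalized_max]). The Lipschitz
    bound keeps the gradient of the penalty bounded ([penalized_displacement]),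
    so the two points are at distance [O(r)], and the consistency error of the
    difference quotients, [h / r], is [O(r)] too ([slope_lower],
    [slope_upper]). The factors of both equations then agree up to [O(r)] and
    are bounded away from zero, whence the quotients have ratio [1 + O(r)]
    ([compare_products], [log_ratio_upper], [log_ratio_lower]). A term
    [r * \sum_i ln y_i] that forces the maximum into the open set where the
    quotient is continuous costs [r * \sum_i - ln x_i] in the conclusion; after
    multiplication by [vol x] this is [O(r)] ([vol_sum_ln]). This gives the
    first estimate, and the second one follows from
    [|a - b| * a ^ (n - 1) <= |a ^ n - b ^ n|] for nonnegative [a] and [b]
    ([ler_root_diff]). *)

(** * Geometry of the cube *)

Section Cube.
Context {R : realType} {n : nat}.
Implicit Types (x y : 'rV[R]_n) (f : 'rV[R]_n -> R).

(** Grid points are moved along one axis at a time, and the coordinates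
    contribute to this distance separately. *)
Definition l1dist x y : R := \sum_i `|x ord0 i - y ord0 i|.
Definition sqdist x y : R := \sum_i (x ord0 i - y ord0 i) ^+ 2.
Definition vol x : R := \prod_i x ord0 i.

Lemma pos_cube_cube x : pos_cube x -> cube x.
Proof. by move=> px i; have /andP[/ltW -> ->] := px i. Qed.

Lemma cube_Gamma_or_pos x : cube x -> Gamma x \/ pos_cube x.
Proof.
move=> cx; have [[i xi]|nz] := pselect (exists i, x ord0 i = 0).
  by left; split=> //; exists i.
right=> i; have /andP[x0 ->] := cx i; rewrite andbT lt_neqAle x0 andbT.
by apply/eqP => e; apply: nz; exists i.
Qed.

Lemma vol_gt0 x : pos_cube x -> 0 < vol x.
Proof. by move=> px; apply: prodr_gt0 => i _; case/andP: (px i). Qed.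

Lemma vol_ge0 x : cube x -> 0 <= vol x.
Proof. by move=> px; apply: prodr_ge0 => i _; case/andP: (px i). Qed.

Lemma vol_le1 x : cube x -> vol x <= 1.
Proof.
by move=> cx; apply: prodr_ile1 => i _; exact: cx.
Qed.

Lemma vol_le_coord x i : cube x -> vol x <= x ord0 i.
Proof.
move=> cx; rewrite /vol (bigD1 i) //=.
have /andP[x0 _] := cx i; rewrite ler_piMr //.
by apply: prodr_ile1 => j _; exact: cx.
Qed.

Lemma vol_Gamma x : Gamma x -> vol x = 0.
Proof. by move=> [_ [i xi]]; rewrite /vol (bigD1 i) //= xi mul0r. Qed.

Lemma continuous_vol : continuous (@vol).
Proof.
move=> x; apply: (@cvg_big R^o 'I_n *%R 1 xpredT _ _ (nbhs x)
  (index_enum 'I_n) (fun i (y : 'rV[R]_n) => y ord0 i : R^o)).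
  by move=> p; exact: mul_continuous.
by move=> i _; exact: coord_continuous.
Qed.

Lemma compact_box (a b : R) :
  compact [set x : 'rV[R]_n | forall i, a <= x ord0 i <= b].
Proof.
have -> : [set x : 'rV[R]_n | forall i, a <= x ord0 i <= b] =
    [set x : 'rV[R]_n | forall i, x ord0 i \in `[a, b]].
  by apply/seteqP; split => x /= cx i; have := cx i; rewrite in_itv.
apply: (@rV_compact _ _ (fun=> `[a, b]%classic)) => i.
exact: segment_compact.
Qed.

Lemma cube_const1 : cube (const_mx 1 : 'rV[R]_n).
Proof. by move=> i; rewrite mxE ler01 lexx. Qed.

Lemma l1dist_ge0 x y : 0 <= l1dist x y.
Proof. exact: sumr_ge0. Qed.

Lemma l1distC x y : l1dist x y = l1dist y x.
Proof. by apply: eq_bigr => i _; rewrite distrC. Qed.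

Lemma l1dist_le_cube x y : cube x -> cube y -> l1dist x y <= n%:R.
Proof.
move=> cx cy; have -> : n%:R = \sum_(i < n) 1 :> R by rewrite sumr_const card_ord.
apply: ler_sum => i _; have := cx i; have := cy i.
by rewrite ler_norml => /andP[? ?] /andP[? ?]; lra.
Qed.

Lemma euclid_norm_le_l1 x y : euclid_norm (x - y) <= l1dist x y.
Proof.
rewrite -[l1dist x y]ger0_norm ?l1dist_ge0// -sqrtr_sqr.
apply: ler_wsqrtr; rewrite expr2 {2}/l1dist mulr_sumr.
apply: ler_sum => i _; rewrite !mxE -real_normK ?num_real// expr2.
apply: ler_wpM2r => //; rewrite /l1dist (bigD1 i) //= lerDl.
exact: sumr_ge0.
Qed.

Lemma euclid_norm_eq0 x : euclid_norm x = 0 -> x = 0.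
Proof.
move/eqP; rewrite sqrtr_eq0 => s0; apply/rowP => i; rewrite mxE.
apply/eqP; rewrite -sqrf_eq0 eq_le sqr_ge0 andbT.
apply: le_trans s0; rewrite (bigD1 i) //= lerDl.
by apply: sumr_ge0 => j _; exact: sqr_ge0.
Qed.

Lemma lipschitz_l1 f x y : lipschitz_on_cube f -> cube x -> cube y ->
  `|f x - f y| <= `|lipschitz_seminorm f| * l1dist x y.
Proof.
move=> Lf cx cy; have [->|xy] := eqVneq x y.
  by rewrite subrr normr0 mulr_ge0 ?l1dist_ge0.
have e0 : 0 < euclid_norm (x - y).
  rewrite lt_neqAle sqrtr_ge0 andbT eq_sym; apply: contra xy => /eqP.
  by move/euclid_norm_eq0/eqP; rewrite subr_eq0.
have : `|f x - f y| / euclid_norm (x - y) <= lipschitz_seminorm f.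
  by apply: (ub_le_sup Lf); exists x, y.
rewrite ler_pdivrMr // => /le_trans; apply.
apply: le_trans (_ : `|lipschitz_seminorm f| * euclid_norm (x - y) <= _).
  by apply: ler_wpM2r; [exact: ltW|exact: ler_norm].
by apply: ler_wpM2l => //; exact: euclid_norm_le_l1.
Qed.

Lemma l1dist_cvg0 x : l1dist y x @[y --> x] --> (0 : R).
Proof.
have -> : 0 = l1dist x x by rewrite /l1dist big1 // => i _; rewrite subrr normr0.
apply: (@cvg_big R^o 'I_n +%R 0 xpredT _ _ (nbhs x)
  (index_enum 'I_n) (fun i (y : 'rV[R]_n) => `|y ord0 i - x ord0 i| : R^o)).
  by move=> p; exact: add_continuous.
move=> i _; apply: cvg_norm; apply: cvgB; last exact: cvg_cst.
exact: coord_continuous.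
Qed.

Lemma lipschitz_continuous_cube f :
  lipschitz_on_cube f -> {within cube, continuous f}.
Proof.
move=> Lf; rewrite continuous_subspace_in => x /set_mem cx.
apply/cvgrPdist_le => e e0.
rewrite -(nbhs_subspace_in cx) near_withinE.
have K1 : 0 < `|lipschitz_seminorm f| + 1 by rewrite ltr_wpDl.
have := l1dist_cvg0 x; move/cvgrPdist_lt => /(_ (e / (`|lipschitz_seminorm f| + 1))).
rewrite divr_gt0 // => /(_ isT); apply: filterS => y.
rewrite sub0r normrN ger0_norm ?l1dist_ge0 // ltr_pdivlMr // => ye cy.
apply: le_trans (lipschitz_l1 _ _ _ Lf cx cy) _; apply/ltW/(le_lt_trans _ ye).
by rewrite l1distC mulrC ler_wpM2l ?l1dist_ge0 // lerDl.
Qed.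

(** Compactness of the cube makes the infimum positive; the upper bound comes
    from the diameter [n] of the cube for [l1dist]. *)
Lemma inf_cube_bounds f : lipschitz_on_cube f ->
    (forall x, cube x -> 0 < f x) ->
  let m := inf (f @` cube) in
  0 < m /\ forall x, cube x ->
    m <= f x <= m + `|lipschitz_seminorm f| * n%:R.
Proof.
move=> Lf f0 m.
have c1 : @cube R n !=set0 by exists (const_mx 1); exact: cube_const1.
have [x0 /set_mem cx0 min0] := compact_EVT_min c1 (compact_box 0 1)
  (lipschitz_continuous_cube _ Lf).
have mE : m = f x0.
  apply/eqP; rewrite eq_le; apply/andP; split.
    apply: ge_inf; last by exists x0.
    by exists (f x0) => _ [x cx <-]; apply: min0; rewrite inE.
  apply: lb_le_inf; first by exists (f x0), x0.
  by move=> _ [x cx <-]; apply: min0; rewrite inE.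
rewrite mE; split=> [|x cx]; first exact: f0.
rewrite min0 ?inE //= -lerBlDl; apply: le_trans (ler_norm _) _.
apply: le_trans (lipschitz_l1 _ _ _ Lf cx cx0) _.
by rewrite ler_wpM2l // l1dist_le_cube.
Qed.

End Cube.

(** * Exponential test functions *)

Section TestFunctions.
Context {R : realType} {n : nat}.
Implicit Types (x y : 'rV[R]_n) (f u : 'rV[R]_n -> R).

(** Reduces directional derivatives to the one-variable calculus, where a chain
    rule for [expR] is available. *)
Lemma is_derive_line (phi : 'rV[R]_n -> R) x v (d : R) :
  is_derive (0 : R) (1 : R) (fun t : R => phi (t *: v + x)) d ->
  is_derive x v phi d.
Proof.
have E : (fun h : R => h^-1 *: ((phi \o shift x) (h *: v) - phi x)) =
   (fun h : R => h^-1 *: (((fun t : R => phi (t *: v + x)) \o shift 0) (h *: 1)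
       - phi (0 *: v + x))).
  apply/funext => h /=; congr (_ *: (phi _ - phi _)).
    by rewrite addr0 [h *: 1]mulr1.
  by rewrite scale0r add0r.
move=> [dl vl]; split; first by rewrite /derivable E.
by rewrite -vl /derive E.
Qed.

Definition exp_quadratic (a b : R) (p : 'I_n -> R) (y0 y : 'rV[R]_n) : R :=
  a * expR (\sum_i (p i * (y ord0 i - y0 ord0 i)
                    + b * (y ord0 i - y0 ord0 i) ^+ 2)).

Lemma exp_quadratic_derive a b p y0 y i :
  is_derive y (basis_vec i) (exp_quadratic a b p y0)
    (exp_quadratic a b p y0 y * (p i + 2 * b * (y ord0 i - y0 ord0 i))).
Proof.
apply: is_derive_line.
set S := \sum_j (p j * (y ord0 j - y0 ord0 j) + b * (y ord0 j - y0 ord0 j) ^+ 2).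
pose k := p i + 2 * b * (y ord0 i - y0 ord0 i).
have -> : (fun t : R => exp_quadratic a b p y0 (t *: basis_vec i + y)) =
    cst a * (expR \o (cst S + (cst k * id + cst b * (id * id)))).
  apply/funext => t.
  transitivity (a * expR (S + (k * t + b * (t * t)))); last by [].
  rewrite /exp_quadratic /S /k; congr (_ * expR _).
  rewrite (bigD1 i) //= [in RHS](bigD1 i) //= !mxE !eqxx /=.
  rewrite (eq_bigr (fun j => p j * (y ord0 j - y0 ord0 j) +
      b * (y ord0 j - y0 ord0 j) ^+ 2)); last first.
    by move=> j ji; rewrite !mxE (negbTE ji) andbF mulr0 add0r.
  ring.
have Hin : is_derive (0:R) (1:R) (cst S + (cst k * id + cst b * (id * id))) k.
  have C (z : R) : is_derive (0 : R) (1 : R) (cst z : R -> R) 0.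
    exact: is_derive_cst.
  have I := is_derive_id (0 : R) (1 : R).
  have D := is_deriveD (C S) (is_deriveD (is_deriveM (C k) I)
    (is_deriveM (C b) (is_deriveM I I))).
  apply: is_derive_eq D _.
  by change (0 + (k * 1 + 0 * 0 + (b * (0 * 1 + 0 * 1) + (0 * 0) * 0)) = k); ring.
have Hexp := is_derive_expR ((cst S + (cst k * id + cst b * (id * id))) (0:R)).
have Hc := is_derive1_comp Hexp Hin.
have Ha := is_derive_cst a (0 : R) (1 : R).
apply: is_derive_eq (is_deriveM Ha Hc) _.
change (a * (expR (S + (k * 0 + b * (0 * 0))) * k) +
  expR (S + (k * 0 + b * (0 * 0))) * 0 = a * expR S * k).
by rewrite !mulr0 !addr0 mulrA.
Qed.

Lemma continuous_exp_quadratic a b p y0 : continuous (exp_quadratic a b p y0).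
Proof.
move=> y; apply: (@cvgM R _ (nbhs y) _ (cst a)); first exact: cvg_cst.
apply: (@continuous_comp _ _ _ _ expR); last exact: continuous_expR.
apply: (@cvg_big R^o 'I_n +%R 0 xpredT _ _ (nbhs y) (index_enum 'I_n)
  (fun i (y : 'rV[R]_n) => p i * (y ord0 i - y0 ord0 i)
                    + b * (y ord0 i - y0 ord0 i) ^+ 2 : R^o)).
  by move=> q; exact: add_continuous.
move=> i _.
have H : (z ord0 i - y0 ord0 i) @[z --> y] --> (y ord0 i - y0 ord0 i).
  apply: (@cvgB R R^o _ (nbhs y) _ (fun z : 'rV[R]_n => z ord0 i)); [exact: (@coord_continuous R 1 n ord0 i y)|exact: cvg_cst].
apply: (@cvgD R _ _ (nbhs y)).
  by apply: (@cvgM R _ (nbhs y) _ (cst (p i))) => //; exact: cvg_cst.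
apply: (@cvgM R _ (nbhs y) _ (cst b)); first exact: cvg_cst.
by under eq_cvg do rewrite expr2; rewrite expr2; exact: (@cvgM R _ (nbhs y)).
Qed.

Lemma exp_quadratic_C1 a b p y0 : C1 (exp_quadratic a b p y0).
Proof.
move=> i; split=> [x|]; first by have [] := exp_quadratic_derive a b p y0 x i.
have -> : (fun x => 'D_(basis_vec i) (exp_quadratic a b p y0) x) =
    (fun y => exp_quadratic a b p y0 y * (p i + 2 * b * (y ord0 i - y0 ord0 i))).
  by apply/funext => x; have [_ ->] := exp_quadratic_derive a b p y0 x i.
move=> y; apply: (@cvgM R _ (nbhs y)); first exact: continuous_exp_quadratic.
apply: (@cvgD R _ _ (nbhs y) _ (cst (p i))); first exact: cvg_cst.
apply: (@cvgM R _ (nbhs y) _ (cst (2 * b))); first exact: cvg_cst.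
by apply: cvgB; [exact: coord_continuous|exact: cvg_cst].
Qed.

Lemma exp_quadratic_center a b p y0 : exp_quadratic a b p y0 y0 = a.
Proof.
rewrite /exp_quadratic big1 ?expR0 ?mulr1 // => i _.
by rewrite subrr mulr0 expr0n /= mulr0 addr0.
Qed.

Lemma near_coords (P : 'I_n -> R -> Prop) x :
  (forall i, \forall t \near x ord0 i, P i t) ->
  nbhs x (fun y : 'rV[R]_n => forall i, P i (y ord0 i)).
Proof.
move=> nP; have H i : nbhs x (fun y : 'rV[R]_n => P i (y ord0 i)).
  exact: (@coord_continuous R 1 n ord0 i x _ (nP i)).
have : nbhs x (fun y : 'rV[R]_n => forall i, i \in enum 'I_n -> P i (y ord0 i)).
  elim: (enum 'I_n) => [|j s IH]; first by apply: filterE.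
  apply: filterS2 (H j) IH => y Pj Ps i.
  by rewrite inE => /orP[/eqP ->|/Ps].
by apply: filterS => y Py i; apply: Py; rewrite mem_enum.
Qed.

Lemma ln_le_tangent (s t : R) : 0 < s -> 0 < t -> ln t - ln s <= (t - s) / s.
Proof.
move=> s0 t0; rewrite -ln_div ?posrE //.
have -> : t / s = 1 + (t - s) / s by field; rewrite gt_eqF.
apply: le_ln1Dx; have : 0 < t / s by exact: divr_gt0.
have -> : t / s = 1 + (t - s) / s by field; rewrite gt_eqF.
by move=> H; lra.
Qed.

(** The curvature constant 2 is the price for letting [t] go down to [s / 2]. *)
Lemma ln_ge_tangent (s t : R) : 0 < s -> s / 2 < t ->
  (t - s) / s - 2 / s ^+ 2 * (t - s) ^+ 2 <= ln t - ln s.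
Proof.
move=> s0 st; have t0 : 0 < t by lra.
have := ln_le_tangent _ _ t0 s0 => H.
apply: le_trans (_ : (t - s) / t <= _); last first.
  have -> : (t - s) / t = - ((s - t) / t) by rewrite -mulNr opprB.
  by lra.
rewrite -subr_ge0.
have -> : (t - s) / t - ((t - s) / s - 2 / s ^+ 2 * (t - s) ^+ 2) =
   (t - s) ^+ 2 * (2 * t - s) / (s ^+ 2 * t).
  by field; rewrite !gt_eqF.
apply: divr_ge0; last by rewrite mulr_ge0 ?sqr_ge0 // ltW.
by rewrite mulr_ge0 ?sqr_ge0 //; lra.
Qed.

(** Test functions must be C1 on the whole space, whereas the natural
    competitors are exponentials of sums of logarithms, defined for positive
    coordinates only; since the touching condition is local, each logarithm is
    replaced by its tangent parabola from the proper side. *)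
Lemma viscosity_super_exp f u (y0 : 'rV[R]_n) (a c b : R) (p : 'I_n -> R) :
  viscosity_solution f u -> pos_cube y0 -> 0 <= a -> 0 <= c ->
  (forall y, pos_cube y ->
     u y0 + a * (expR (\sum_i (c * (ln (y ord0 i) - ln (y0 ord0 i))
                      + p i * (y ord0 i - y0 ord0 i)
                      - b * (y ord0 i - y0 ord0 i) ^+ 2)) - 1) <= u y) ->
  f y0 <= \prod_i pos_part (a * (c / y0 ord0 i + p i)).
Proof.
move=> [_ _ _ super] py0 a0 c0 H.
pose B := b + c * \sum_i 2 / y0 ord0 i ^+ 2.
pose phi := exp_quadratic a (- B) (fun i => c / y0 ord0 i + p i) y0.
have ypos i : 0 < y0 ord0 i by have /andP[] := py0 i.
have -> : \prod_i pos_part (a * (c / y0 ord0 i + p i)) =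
          \prod_i pos_part ('D_(basis_vec i) phi y0).
  apply: eq_bigr => i _; congr pos_part.
  have [_ ->] := exp_quadratic_derive a (- B) (fun i => c / y0 ord0 i + p i) y0 y0 i.
  by rewrite exp_quadratic_center subrr mulr0 addr0.
apply: super => //; first exact: exp_quadratic_C1.
have N : nbhs y0 (fun y : 'rV[R]_n => forall i, y0 ord0 i / 2 < y ord0 i).
  apply: (near_coords (fun i t => y0 ord0 i / 2 < t)) => i.
  by apply: lt_nbhsr; have := ypos i; lra.
apply: filterS N => y yy py /=.
rewrite /phi exp_quadratic_center; have := H y py.
suff : a * expR (\sum_i ((c / y0 ord0 i + p i) * (y ord0 i - y0 ord0 i)
         + - B * (y ord0 i - y0 ord0 i) ^+ 2)) <=
     a * expR (\sum_i (c * (ln (y ord0 i) - ln (y0 ord0 i))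
          + p i * (y ord0 i - y0 ord0 i) - b * (y ord0 i - y0 ord0 i) ^+ 2)).
  by rewrite /exp_quadratic => h1 h2; lra.
apply: ler_wpM2l => //; rewrite ler_expR; apply: ler_sum => i _.
have h1 := ln_ge_tangent _ _ (ypos i) (yy i).
have h2 : c * (2 / y0 ord0 i ^+ 2) * (y ord0 i - y0 ord0 i) ^+ 2 <=
          (B - b) * (y ord0 i - y0 ord0 i) ^+ 2.
  apply: ler_wpM2r; first exact: sqr_ge0.
  rewrite /B addrAC subrr add0r; apply: ler_wpM2l => //.
  rewrite (bigD1 i) //= lerDl; apply: sumr_ge0 => j _.
  by rewrite divr_ge0 // sqr_ge0.
have := ler_wpM2l c0 h1; set d := _ - _ in h1 h2 *.
set l := ln _ - ln _.
by move=> h3; rewrite mulrBr mulrA in h3; lra.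
Qed.

(** Here the tangent line of the logarithm lies on the proper side already. *)
Lemma viscosity_sub_exp f u (y0 : 'rV[R]_n) (a c b : R) (p : 'I_n -> R) :
  viscosity_solution f u -> pos_cube y0 -> 0 <= a -> 0 <= c ->
  (forall y, pos_cube y ->
     u y <= u y0 + a * (expR (\sum_i (c * (ln (y ord0 i) - ln (y0 ord0 i))
                      + p i * (y ord0 i - y0 ord0 i)
                      + b * (y ord0 i - y0 ord0 i) ^+ 2)) - 1)) ->
  \prod_i pos_part (a * (c / y0 ord0 i + p i)) <= f y0.
Proof.
move=> [_ _ sub _] py0 a0 c0 H.
pose phi := exp_quadratic a b (fun i => c / y0 ord0 i + p i) y0.
have ypos i : 0 < y0 ord0 i by have /andP[] := py0 i.
have -> : \prod_i pos_part (a * (c / y0 ord0 i + p i)) =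
          \prod_i pos_part ('D_(basis_vec i) phi y0).
  apply: eq_bigr => i _; congr pos_part.
  have [_ ->] := exp_quadratic_derive a b (fun i => c / y0 ord0 i + p i) y0 y0 i.
  by rewrite exp_quadratic_center subrr mulr0 addr0.
apply: sub => //; first exact: exp_quadratic_C1.
apply: filterE => y py /=.
rewrite /phi exp_quadratic_center; have := H y py.
suff : a * expR (\sum_i (c * (ln (y ord0 i) - ln (y0 ord0 i))
          + p i * (y ord0 i - y0 ord0 i) + b * (y ord0 i - y0 ord0 i) ^+ 2)) <=
   a * expR (\sum_i ((c / y0 ord0 i + p i) * (y ord0 i - y0 ord0 i)
         + b * (y ord0 i - y0 ord0 i) ^+ 2)).
  by rewrite /exp_quadratic => h1 h2; lra.
apply: ler_wpM2l => //; rewrite ler_expR; apply: ler_sum => i _.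
have yi : 0 < y ord0 i by have /andP[] := py i.
have := ler_wpM2l c0 (ln_le_tangent _ _ (ypos i) yi).
set l := ln _ - ln _; set d := _ - _.
by move=> h3; lra.
Qed.

End TestFunctions.

(** * Barriers for the viscosity solution *)

Section Barriers.
Context {R : realType} {n : nat}.
Implicit Types (x y : 'rV[R]_n) (f u : 'rV[R]_n -> R).

Lemma ln_vol x : pos_cube x -> ln (vol x) = \sum_i ln (x ord0 i).
Proof.
move=> px; rewrite -[RHS]expRK expR_sum /vol; congr ln.
by apply: eq_bigr => i _; rewrite lnK // posrE; case/andP: (px i).
Qed.

(** [powR] is constantly 1 on negative bases, hence the absolute value. *)
Lemma continuous_abs_powR (a : R) : 0 < a -> continuous (fun t : R => `|t| `^ a).
Proof.
move=> a0 t; have [->|t0] := eqVneq t 0.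
  rewrite /continuous_at normr0 powR0 ?gt_eqF //.
  apply/cvgrPdist_lt => e e0.
  have d0 : 0 < e `^ a^-1 by rewrite powR_gt0.
  exists (e `^ a^-1) => // s; rewrite /ball_ /= sub0r normrN => sd.
  rewrite sub0r normrN ger0_norm ?powR_ge0 //.
  have -> : e = (e `^ a^-1) `^ a.
    by rewrite -powRrM mulVf ?gt_eqF // powRr1 // ltW.
  by rewrite gt0_ltr_powR // ?nnegrE ?powR_ge0.
have an : 0 < `|t| by rewrite normr_gt0.
apply: (@continuous_comp R R R (fun t : R => `|t|) (fun s : R => s `^ a)).
  exact: norm_continuous.
apply: differentiable_continuous; apply/derivable1_diffP.
by apply: derivable_powR; rewrite in_itv /= andbT.
Qed.

(** For a constant right-hand side [c] the equation is solved exactly by this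
    multiple of the geometric mean of the coordinates. *)
Definition const_sol (c : R) x : R := n%:R * `|c * vol x| `^ n%:R^-1.

Hypothesis hn : (0 < n)%N.

Let n0 : 0 < n%:R :> R. Proof. by rewrite ltr0n. Qed.

Lemma continuous_const_sol c : continuous (const_sol c).
Proof.
move=> x; apply: (@cvgM R _ (nbhs x) _ (cst n%:R)); first exact: cvg_cst.
apply: (@continuous_comp _ R R (fun x => c * vol x) (fun t => `|t| `^ n%:R^-1)).
  apply: (@cvgM R _ (nbhs x) _ (cst c)); first exact: cvg_cst.
  exact: continuous_vol.
by apply: continuous_abs_powR; rewrite invr_gt0.
Qed.

Lemma const_sol_Gamma c x : Gamma x -> const_sol c x = 0.
Proof.
by move=> gx; rewrite /const_sol vol_Gamma // mulr0 normr0 powR0 ?mulr0 // gt_eqF ?invr_gt0.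
Qed.

Lemma const_sol_gt0 c x : 0 < c -> pos_cube x -> 0 < const_sol c x.
Proof.
move=> c0 px; rewrite mulr_gt0 // powR_gt0 // normr_gt0 gt_eqF //.
by rewrite mulr_gt0 // vol_gt0.
Qed.

Lemma const_solX c x : 0 < c -> cube x -> (const_sol c x / n%:R) ^+ n = c * vol x.
Proof.
move=> c0 cx; rewrite /const_sol mulrC mulKf ?gt_eqF //.
have cv : 0 <= c * vol x by rewrite mulr_ge0 ?vol_ge0 // ltW.
rewrite ger0_norm // -powR_mulrn ?powR_ge0 // -powRrM mulVf ?gt_eqF //.
by rewrite powRr1.
Qed.

Lemma const_sol_ratio c x y : 0 < c -> pos_cube x -> pos_cube y ->
  const_sol c y = const_sol c x *
    expR (\sum_i (n%:R^-1 * (ln (y ord0 i) - ln (x ord0 i)))).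
Proof.
move=> c0 px py; have vx := vol_gt0 _ px; have vy := vol_gt0 _ py.
rewrite /const_sol !gtr0_norm ?mulr_gt0 // -mulrA; congr (_ * _).
rewrite -mulr_sumr sumrB -!ln_vol //.
rewrite /powR !gt_eqF ?mulr_gt0 // -expRD; congr expR.
by rewrite !lnM ?posrE //; ring.
Qed.

Lemma const_sol_slopes c x : 0 < c -> pos_cube x ->
  \prod_i pos_part (const_sol c x * (n%:R^-1 / x ord0 i + 0)) = c.
Proof.
move=> c0 px; transitivity (\prod_i (const_sol c x / n%:R / x ord0 i)).
  apply: eq_bigr => i _; rewrite addr0 mulrA /pos_part; apply/max_idPl.
  have /andP[xi _] := px i.
  by rewrite !mulr_ge0 ?invr_ge0 ?(ltW xi) // ltW // const_sol_gt0.
rewrite prodf_div big_const_ord iter_mulr_1 const_solX //; last exact: pos_cube_cube.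
by rewrite -/(vol x) mulfK // gt_eqF // vol_gt0.
Qed.

(** The difference vanishes on [Gamma], so that a negative minimum would lie in
    [pos_cube], where [const_sol c] is a test function whose slopes have product
    [c < f]. *)
Lemma const_sol_le_u c f u x : viscosity_solution f u -> 0 < c ->
  (forall y, cube y -> c < f y) -> cube x -> const_sol c x <= u x.
Proof.
move=> vu c0 cf cx; have [uc uG _ _] := vu.
have cc : {within cube, continuous (fun y => u y - const_sol c y)}.
  move=> y; apply: (@cvgB R _ _ (nbhs y)); first exact: uc.
  exact: (continuous_subspaceT (@continuous_const_sol c)).
have c1 : @cube R n !=set0 by exists (const_mx 1); exact: cube_const1.
have [y0 /set_mem cy0 min0] := compact_EVT_min c1 (compact_box 0 1) cc.
rewrite -subr_ge0; apply: le_trans (min0 x (mem_set cx)).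
have [gy0|py0] := cube_Gamma_or_pos _ cy0.
  by rewrite uG // const_sol_Gamma // subrr.
rewrite leNgt; apply/negP => neg.
suff : f y0 <= c by rewrite leNgt cf.
rewrite -[leRHS](const_sol_slopes c y0) //.
apply: (viscosity_super_exp f u y0 (const_sol c y0) n%:R^-1 0 (fun=> 0)) => //.
  exact/ltW/const_sol_gt0.
move=> y py; under eq_bigr do rewrite !mul0r addr0 subr0.
have := min0 y (mem_set (pos_cube_cube _ py)).
by rewrite (const_sol_ratio c y0 y) //; lra.
Qed.

Lemma u_le_const_sol c f u x : viscosity_solution f u -> 0 < c ->
  (forall y, cube y -> f y < c) -> cube x -> u x <= const_sol c x.
Proof.
move=> vu c0 cf cx; have [uc uG _ _] := vu.
have cc : {within cube, continuous (fun y => u y - const_sol c y)}.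
  move=> y; apply: (@cvgB R _ _ (nbhs y)); first exact: uc.
  exact: (continuous_subspaceT (@continuous_const_sol c)).
have c1 : @cube R n !=set0 by exists (const_mx 1); exact: cube_const1.
have [y0 /set_mem cy0 max0] := compact_EVT_max c1 (compact_box 0 1) cc.
rewrite -subr_le0; apply: le_trans (max0 x (mem_set cx)) _.
have [gy0|py0] := cube_Gamma_or_pos _ cy0.
  by rewrite uG // const_sol_Gamma // subrr.
rewrite leNgt; apply/negP => neg.
suff : c <= f y0 by rewrite leNgt cf.
rewrite -[leLHS](const_sol_slopes c y0) //.
apply: (viscosity_sub_exp f u y0 (const_sol c y0) n%:R^-1 0 (fun=> 0)) => //.
  exact/ltW/const_sol_gt0.
move=> y py; under eq_bigr do rewrite !mul0r !addr0.
have := max0 y (mem_set (pos_cube_cube _ py)).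
by rewrite (const_sol_ratio c y0 y) //; lra.
Qed.

(** The factors of 2 make room for the strict inequalities that the barriers
    require. *)
Lemma u_bounds f u (m M : R) : viscosity_solution f u -> 0 < m ->
  (forall y, cube y -> m <= f y <= M) ->
  forall x, pos_cube x -> 0 < u x /\
    m / 2 * vol x <= (u x / n%:R) ^+ n <= 2 * M * vol x.
Proof.
move=> vu m0 mfM x px; have cx := pos_cube_cube _ px.
have M0 : 0 < M by have /andP[h1 h2] := mfM _ cx; lra.
have lo : const_sol (m / 2) x <= u x.
  by apply: (const_sol_le_u _ f) => // [|y /mfM /andP[h1 h2]]; lra.
have hi : u x <= const_sol (2 * M) x.
  by apply: (u_le_const_sol _ f) => // [|y /mfM /andP[h1 h2]]; lra.
have m20 : 0 < m / 2 by lra.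
have M20 : 0 < 2 * M by lra.
have s0 := const_sol_gt0 _ x m20 px.
have u0 : 0 < u x by apply: lt_le_trans lo.
have ni : 0 <= (n%:R : R)^-1 by rewrite invr_ge0.
split=> //; rewrite -!const_solX //.
by rewrite !ler_pXn2r ?nnegrE ?mulr_ge0 // ?ler_wpM2r ?(ltW u0) ?(ltW s0) // ltW // const_sol_gt0.
Qed.

End Barriers.

(** * Grid points and the local equation *)

Lemma finite_set_argmax {R : realType} {T : eqType} (A : set T) (F : T -> R) :
  finite_set A -> A !=set0 -> exists2 a, A a & forall b, A b -> F b <= F a.
Proof.
move=> /finite_seqP[s ->]; elim: s => [[a]//|a s IH _].
have [s0|/set0P/IH[b sb maxb]] := eqVneq [set` s] set0.
  exists a => [|c] /=; rewrite ?mem_head // inE => /orP[/eqP -> //|sc].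
  by have : [set` s] c by []; rewrite s0.
have [ba|/ltW ab] := leP (F b) (F a).
  exists a => [|c] /=; rewrite ?mem_head // inE => /orP[/eqP -> //|sc].
  exact: le_trans (maxb _ sc) ba.
exists b => [|c] /=; first by rewrite inE sb orbT.
by rewrite inE => /orP[/eqP -> //|/maxb].
Qed.

Section Grid.
Context {R : realType} {n : nat}.
Implicit Types (x y : 'rV[R]_n) (f u v : 'rV[R]_n -> R).
Variable h : R.
Hypothesis h0 : 0 < h.

Definition pos_grid : set 'rV[R]_n := pos_cube `&` grid h.
Definition back i x : 'rV[R]_n := x - h *: basis_vec i.

Lemma backE i x j : back i x ord0 j = x ord0 j - (if j == i then h else 0).
Proof. by rewrite !mxE eqxx /= eq_sym; case: eqP => _; rewrite ?mulr1 ?mulr0. Qed.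

Lemma back_id i x : back i x ord0 i = x ord0 i - h.
Proof. by rewrite backE eqxx. Qed.

Lemma back_neq i x j : j != i -> back i x ord0 j = x ord0 j.
Proof. by rewrite backE => /negbTE ->; rewrite subr0. Qed.

Lemma finite_pos_grid : finite_set pos_grid.
Proof.
pose N := (Num.truncn (h^-1)).+1.
pose pt (k : {ffun 'I_n -> 'I_N}) : 'rV[R]_n := \row_i (h * (k i)%:R).
apply: (@sub_finite_set _ _ (range pt)); last first.
  by apply: finite_image; exact: finite_finset.
move=> x [px gx]; pose k i := sval (cid (gx i)).
have kE i : x ord0 i = h * (k i)%:~R by rewrite /k; case: cid.
have k0 i : 0 <= k i.
  have /andP[] := px i; rewrite kE pmulr_rgt0 // ltr0z => *; exact: ltW.
have kN i : (`|k i| < N)%N.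
  rewrite /N; have /andP[_] := px i.
  rewrite kE -[k i]gez0_abs // => k1.
  have : (`|k i|%:R : R) <= h^-1.
    by rewrite -[h^-1]mul1r ler_pdivlMr // mulrC.
  by move=> kh; rewrite -(@ltr_nat R); apply: le_lt_trans kh _; exact: truncnS_gt.
exists [ffun i => Ordinal (kN i)] => //.
by apply/rowP => i; rewrite !mxE ffunE /= kE -[in RHS](gez0_abs (k0 i)).
Qed.

Lemma pos_grid_argmax (F : 'rV[R]_n -> R) : pos_grid !=set0 ->
  exists2 x, pos_grid x & forall y, pos_grid y -> F y <= F x.
Proof. exact: finite_set_argmax finite_pos_grid. Qed.

Lemma pos_grid_cube x : pos_grid x -> cube x.
Proof. by move=> [/pos_cube_cube]. Qed.

Lemma pos_grid_ge x i : pos_grid x -> h <= x ord0 i.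
Proof.
move=> [px gx]; have [k xk] := gx i; have /andP[] := px i.
rewrite xk pmulr_rgt0 // ltr0z => k0 _.
by rewrite -[leLHS]mulr1 ler_wpM2l ?(ltW h0) // ler1z.
Qed.

Lemma grid_back x i : grid h x -> grid h (back i x).
Proof.
move=> gx j; have [k xk] := gx j; rewrite backE xk.
case: eqP => _; last by exists k; rewrite subr0.
by exists (k - 1); rewrite rmorphB /= mulrBr mulr1.
Qed.

(** The alternative behind every argument on the grid: one step back from the
    first layer the scheme uses the boundary value, elsewhere a grid point of the
    same kind. *)
Lemma pos_grid_back x i : pos_grid x ->
  (x ord0 i = h /\ (Gamma `&` grid h) (back i x)) \/
  (h < x ord0 i /\ pos_grid (back i x)).
Proof.
move=> Gx; have xh := pos_grid_ge x i Gx; have [px gx] := Gx.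
have gb := grid_back x i gx.
have cb : cube (back i x).
  move=> j; rewrite backE; have /andP[a b] := px j; move: xh.
  by have hp := h0; case: eqP => [<-|_]; rewrite ?subr0 => ?; apply/andP; split; lra.
move: (xh); rewrite le_eqVlt => /orP[/eqP xE|lt].
  left; split; first by [].
  by split=> //; split=> //; exists i; rewrite back_id -xE subrr.
right; split=> //; split=> // j; have /andP[_ ->] := cb j; rewrite andbT.
by rewrite backE; have /andP[a _] := px j; case: eqP => [->|_]; lra.
Qed.

End Grid.

Section LocalEquation.
Context {R : realType} {n : nat}.
Hypothesis hn : (0 < n)%N.
Variables (h : R) (a : 'I_n -> R) (fx : R).
Hypothesis h0 : 0 < h.
Hypothesis a0 : forall i, 0 <= a i.
Hypothesis fx0 : 0 < fx.

Let expn_pred (t : R) : t ^+ n = t * t ^+ n.-1.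
Proof. by rewrite -exprS prednK. Qed.

(** Zero is a root as well when [n] is at least 2, so the intermediate value
    theorem is applied on an interval that stays away from it. *)
Lemma scheme_root_gt0 :
  exists2 t, 0 < t & \prod_i pos_part ((t - a i) / h) = t ^+ n.-1 * fx.
Proof.
pose F t := \prod_i pos_part ((t - a i) / h) - t ^+ n.-1 * fx.
pose S := \sum_i a i; pose t0 := h ^+ n * fx.
pose T := 2 * S + (2 * h) ^+ n * fx.
have S0 : 0 <= S by exact: sumr_ge0.
have t00 : 0 < t0 by rewrite mulr_gt0 // exprn_gt0.
have tT : t0 <= T.
  rewrite /T ler_wpDl ?mulr_ge0 // ler_wpM2r ?(ltW fx0) //.
  by have hp := h0; rewrite lerXn2r ?nnegrE //; lra.
have T0 : 0 < T by apply: lt_le_trans tT.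
have cF : continuous F.
  move=> t; apply: (@cvgB R R^o _ (nbhs t)).
    apply: (@cvg_big R^o 'I_n *%R 1 xpredT _ _ (nbhs t) (index_enum 'I_n)
      (fun i (t : R) => pos_part ((t - a i) / h) : R^o)).
      by move=> q; exact: mul_continuous.
    move=> i _; rewrite /pos_part.
    apply: (@continuous_max _ _ (fun t => (t - a i) / h) (cst 0)).
      apply: (@cvgM R _ (nbhs t) _ _ (cst h^-1)); last exact: cvg_cst.
      apply: (@cvgB R R^o _ (nbhs t) _ id (cst (a i))); last exact: cvg_cst.
      exact: cvg_id.
    exact: cvg_cst.
  apply: (@cvgM R _ (nbhs t) _ _ (cst fx)); last exact: cvg_cst.
  exact: exprn_continuous.
(* Each factor is at most [t0 / h] because the [a i] are nonnegative. *)
have F0 : F t0 <= 0.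
  rewrite /F subr_le0.
  have -> : t0 ^+ n.-1 * fx = \prod_(i < n) (t0 / h).
    rewrite big_const_ord iter_mulr_1 expr_div_n expn_pred mulrAC mulrC.
    by congr (_ * _); rewrite /t0 mulrAC divff ?mul1r // expf_neq0 ?gt_eqF.
  apply: ler_prod => i _; rewrite /pos_part le_max lexx orbT /= ge_max.
  rewrite ler_wpM2r ?invr_ge0 ?(ltW h0) ?gerBl //=.
  by rewrite divr_ge0 ?ltW.
(* Each factor is at least [T / (2 * h)] because [a i <= T / 2]. *)
have FT : 0 <= F T.
  rewrite /F subr_ge0; apply: le_trans (_ : \prod_(i < n) (T / (2 * h)) <= _).
    rewrite big_const_ord iter_mulr_1 expr_div_n expn_pred.
    rewrite -mulrA mulrCA ler_wpM2l ?exprn_ge0 ?(ltW T0) //.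
    rewrite ler_pdivlMr ?exprn_gt0 ?mulr_gt0 // mulrC /T ler_wpDl //.
    by rewrite mulr_ge0.
  apply: ler_prod => i _; apply/andP; split.
    by rewrite divr_ge0 ?mulr_ge0 // ltW.
  rewrite /pos_part le_max invfM mulrA ler_wpM2r ?invr_ge0 ?(ltW h0) //=.
  have : a i <= S by rewrite /S (bigD1 i) //= lerDl sumr_ge0.
  have : 0 <= (2 * h) ^+ n * fx by rewrite mulr_ge0 ?exprn_ge0 ?mulr_ge0 // ltW.
  by rewrite /T; lra.
have [t /andP[tt _] Ft] : exists2 t, t0 <= t <= T & F t = 0.
  have [|t] := @IVT R F t0 T 0 tT (continuous_subspaceT cF).
    by rewrite ge_min le_max F0 FT orbT.
  by rewrite in_itv /= => tt Ft; exists t.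
exists t; first exact: lt_le_trans tt.
by apply/eqP; rewrite -subr_eq0 -/(F t) Ft.
Qed.

End LocalEquation.

(** * The normalized scheme *)

Section Scheme.
Context {R : realType} {n : nat}.
Implicit Types (x y : 'rV[R]_n).
Variables (f v : 'rV[R]_n -> R) (h : R).
Hypothesis hn : (0 < n)%N.
Hypothesis h0 : 0 < h.
Hypothesis f0 : forall x, cube x -> 0 < f x.
Hypothesis sv : maximal_scheme_solution h f v.

Local Notation G := (pos_grid h).
Local Notation back := (back h).

Lemma scheme_boundary x i : G x -> x ord0 i = h -> v (back i x) = 0.
Proof.
move=> Gx xh; have [[_ gb]|[]] := pos_grid_back h h0 x i Gx.
  exact: sv.1.
by rewrite xh ltxx.
Qed.

(** At a negative minimum all difference quotients would be nonpositive, and the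
    left-hand side of the scheme would vanish. *)
Lemma scheme_v_ge0 x : G x -> 0 <= v x.
Proof.
move=> Gx; have [y Gy miny] : exists2 y, G y & forall z, G z -> - v z <= - v y.
  by apply: pos_grid_argmax => //; exists x.
suff : 0 <= v y by move=> /le_trans; apply; rewrite -lerN2 miny.
rewrite leNgt; apply/negP => vy; have [E _] := sv.2 y Gy.
have bd0 i : back_diff h i v y <= 0.
  rewrite /back_diff pmulr_lle0 ?invr_gt0 // subr_le0.
  have [[_ gb]|[_ Gb]] := pos_grid_back h h0 y i Gy.
    by have /= := sv.1 _ gb; rewrite /back => ->; exact: ltW.
  by have := miny _ Gb; rewrite lerN2.
move: E; rewrite /scheme_at (bigD1 (Ordinal hn)) //= /pos_part.
rewrite max_r // mul0r => /esym/eqP; rewrite mulf_eq0.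
rewrite (gt_eqF (f0 _ (pos_grid_cube _ _ Gy))) orbF.
by rewrite expf_eq0 (lt_eqF vy) andbF.
Qed.

(** Maximality selects the right root: the positive root of the local equation
    is an admissible competitor. *)
Lemma scheme_v_gt0 x : G x -> 0 < v x.
Proof.
move=> Gx.
have nb i : v (back i x) >= 0.
  have [[_ gb]|[_ Gb]] := pos_grid_back h h0 x i Gx; last exact: scheme_v_ge0.
  by rewrite sv.1.
have [t t0 tE] := scheme_root_gt0 hn h (fun i => v (back i x)) (f x) h0 nb
  (f0 _ (pos_grid_cube _ _ Gx)).
apply: lt_le_trans t0 _.
pose w := fun y => if y == x then t else v y.
have bx i : (back i x == x) = false.
  apply/eqP => /rowP/(_ i); rewrite back_id => /eqP.
  by rewrite -subr_eq0 addrAC subrr add0r oppr_eq0 gt_eqF.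
have wb i : w (back i x) = v (back i x) by rewrite /w bx.
have := (sv.2 x Gx).2 w wb; rewrite {2}/w eqxx; apply.
rewrite /scheme_at {2}/w eqxx -tE; apply: eq_bigr => i _.
by rewrite /back_diff -/(back i x) wb /w eqxx.
Qed.

Lemma scheme_back_diff_gt0 x i : G x -> 0 < back_diff h i v x.
Proof.
move=> Gx; have [E _] := sv.2 x Gx.
have : \prod_(i < n) pos_part (back_diff h i v x) != 0.
  rewrite E mulf_neq0 ?expf_neq0 ?gt_eqF ?scheme_v_gt0 //.
  exact/f0/(pos_grid_cube _ _ Gx).
move/prodf_neq0 => /(_ i isT); rewrite /pos_part.
by case: ltP => // _; rewrite eqxx.
Qed.

(** In the quotient by the volume the scheme becomes
    [normalized * \prod slope = f]: an equation that increases strictly in the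
    unknown and is solved by constants when [f] is constant. *)
Definition normalized x : R := v x / vol x.
Definition slope i x : R := x ord0 i * back_diff h i v x / v x.

Lemma normalized_gt0 x : G x -> 0 < normalized x.
Proof. by move=> Gx; rewrite divr_gt0 ?scheme_v_gt0 // vol_gt0 //; case: Gx. Qed.

Lemma slope_gt0 x i : G x -> 0 < slope i x.
Proof.
move=> Gx; apply: divr_gt0; last exact: scheme_v_gt0.
by apply: mulr_gt0; [case/andP: (Gx.1 i)|exact: scheme_back_diff_gt0].
Qed.

Lemma normalized_prod_slope x : G x -> normalized x * \prod_i slope i x = f x.
Proof.
move=> Gx; have [E _] := sv.2 x Gx.
have {}E : \prod_(i < n) back_diff h i v x = v x ^+ n.-1 * f x.
  rewrite -E; apply: eq_bigr => i _; rewrite /pos_part; symmetry.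
  by apply/max_idPl; exact/ltW/scheme_back_diff_gt0.
rewrite /slope prodf_div big_split /= E big_const_ord iter_mulr_1 -/(vol x).
have -> : v x ^+ n = v x * v x ^+ n.-1 by rewrite -exprS prednK.
have vx := gt_eqF (scheme_v_gt0 _ Gx); have volx := gt_eqF (vol_gt0 _ Gx.1).
have vp : v x ^+ n.-1 != 0 by rewrite expf_neq0 ?vx.
by rewrite /normalized; field; rewrite vp vx volx.
Qed.

(** Next to the boundary the slope is 1 whatever the grid function is, just as
    the weight [x_i] of the continuous equation degenerates there. *)
Lemma slope_first x i : G x -> x ord0 i = h -> slope i x = 1.
Proof.
move=> Gx xh; rewrite /slope /back_diff -/(back i x) scheme_boundary // subr0 xh.
have vx := gt_eqF (scheme_v_gt0 _ Gx).
by field; rewrite vx gt_eqF.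
Qed.

Lemma vol_back x i : x ord0 i != 0 ->
  vol (back i x) = vol x * ((x ord0 i - h) / x ord0 i).
Proof.
move=> xi; rewrite /vol (bigD1 i) //= [in RHS](bigD1 i) //= back_id.
rewrite (eq_bigr (fun j => x ord0 j)) => [|j ji]; last by rewrite back_neq.
by field.
Qed.

Lemma slope_next x i : G x -> h < x ord0 i ->
  slope i x = 1 + (x ord0 i - h) * (1 - normalized (back i x) / normalized x) / h.
Proof.
move=> Gx xh; have xi : x ord0 i != 0 by rewrite gt_eqF // (lt_trans h0).
rewrite /slope /back_diff -/(back i x) /normalized vol_back //.
have vx := gt_eqF (scheme_v_gt0 _ Gx); have volx := gt_eqF (vol_gt0 _ Gx.1).
have xhn : x ord0 i - h != 0 by rewrite subr_eq0 gt_eqF.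
by field; rewrite vx volx xi xhn gt_eqF.
Qed.

Variables m M : R.
Hypothesis m0 : 0 < m.
Hypothesis mfM : forall x, cube x -> m <= f x <= M.

(** At a maximum (minimum) point of the quotient every slope is at least (at
    most) 1, so that the quotient is bounded there by the value of [f]. *)
Lemma normalized_bounds x : G x -> m <= normalized x <= M.
Proof.
move=> Gx; have G0 : (G : set 'rV[R]_n) !=set0 by exists x.
apply/andP; split.
  have [y Gy miny] := pos_grid_argmax h h0 (fun z => - normalized z) G0.
  suff : m <= normalized y by move/le_trans; apply; rewrite -lerN2 miny.
  have /andP[fy _] := mfM _ (pos_grid_cube _ _ Gy); apply: le_trans fy _.
  rewrite -normalized_prod_slope // ler_piMr ?(ltW (normalized_gt0 _ Gy)) //.
  apply: prodr_ile1 => i _; rewrite (ltW (slope_gt0 _ _ Gy)) /=.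
  have [[yh _]|[yh Gb]] := pos_grid_back h h0 y i Gy; first by rewrite slope_first.
  rewrite slope_next // gerDl pmulr_lle0 ?invr_gt0 // pmulr_rle0 ?subr_gt0 //.
  rewrite subr_le0 ler_pdivlMr ?normalized_gt0 // mul1r.
  by rewrite -lerN2; exact: miny.
have [y Gy maxy] := pos_grid_argmax h h0 normalized G0.
apply: le_trans (maxy _ Gx) _.
have /andP[_ fy] := mfM _ (pos_grid_cube _ _ Gy); apply: le_trans fy.
rewrite -normalized_prod_slope // ler_peMr ?(ltW (normalized_gt0 _ Gy)) //.
apply: le_trans (_ : \prod_(i < n) 1 <= _); first by rewrite big1.
apply: ler_prod => i _; rewrite ler01 /=.
have [[yh _]|[yh Gb]] := pos_grid_back h h0 y i Gy; first by rewrite slope_first.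
rewrite slope_next // lerDl pmulr_lge0 ?invr_gt0 // pmulr_rge0 ?subr_gt0 //.
rewrite subr_ge0 ler_pdivrMr ?normalized_gt0 // mul1r.
exact: maxy.
Qed.

Variable L : R.
Hypothesis L0 : 0 <= L.
Hypothesis fL : forall x y, cube x -> cube y -> `|f x - f y| <= L * l1dist x y.

Lemma ln_f_lipschitz x y : cube x -> cube y ->
  ln (f x) - ln (f y) <= L / m * l1dist x y.
Proof.
move=> cx cy; have fx := f0 _ cx; have fy := f0 _ cy.
apply: le_trans (ln_le_tangent _ _ fy fx) _.
apply: le_trans (_ : `|f x - f y| / f y <= _).
  by rewrite ler_wpM2r ?ler_norm // invr_ge0 ltW.
rewrite mulrAC; apply: ler_pM => //; first by rewrite invr_ge0 ltW.
  exact: fL.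
by rewrite lef_pV2 ?posrE //; have /andP[] := mfM _ cy.
Qed.

Lemma grid_gap x y i : G x -> G y -> y ord0 i < x ord0 i ->
  h <= x ord0 i - y ord0 i.
Proof.
move=> [_ gx] [_ gy]; have [k ->] := gx i; have [l ->] := gy i.
rewrite ltr_pM2l // ltr_int => lk; rewrite -mulrBr -rmorphB /=.
by rewrite -[leLHS]mulr1 ler_wpM2l ?(ltW h0) // ler1z; rewrite -gtz0_ge1 subr_gt0.
Qed.

Lemma l1dist_back2 x y i : l1dist (back i x) (back i y) = l1dist x y.
Proof.
by apply: eq_bigr => j _; rewrite !backE opprB addrA subrK.
Qed.

Lemma l1dist_backl x y i : h <= x ord0 i - y ord0 i ->
  l1dist (back i x) y <= l1dist x y.
Proof.
move=> xy; have hp := h0; apply: ler_sum => j _; rewrite backE.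
case: eqP => [->|_]; last by rewrite subr0.
by rewrite !ger0_norm; lra.
Qed.

(** Doubling of variables on the grid. At a maximum point [(x, y)] of
    [ln g x - ln g y - K |x - y|] every slope at [x] dominates the slope at
    [y]: moving both points back compares the difference quotients, and moving
    the larger coordinate back fixes their signs, so that the weight [x_i - h]
    of the quotient acts in the favourable direction even though it vanishes at
    the boundary. *)
Lemma ln_normalized_lipschitz x y : G x -> G y ->
  ln (normalized x) - ln (normalized y) <= L / m * l1dist x y.
Proof.
move=> Gx0 Gy0.
have K0 : 0 <= L / m by rewrite divr_ge0 // ltW.
pose lg z := ln (normalized z).
pose F (z : 'rV[R]_n * 'rV[R]_n) := lg z.1 - lg z.2 - L / m * l1dist z.1 z.2.
suff: F (x, y) <= 0 by rewrite /F /lg /=; lra.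
have [[x1 y1] [/= Gx Gy] maxF] :
    exists2 z, (G `*` G) z & forall z', (G `*` G) z' -> F z' <= F z.
  apply: finite_set_argmax; last by exists (x, y).
  by apply: finite_setX; exact: finite_pos_grid.
apply: le_trans (maxF (x, y) _) _; first by [].
have gx := normalized_gt0 x1 Gx; have gy := normalized_gt0 y1 Gy.
have cx := pos_grid_cube _ _ Gx; have cy := pos_grid_cube _ _ Gy.
have backx i : G (back i x1) -> h <= x1 ord0 i - y1 ord0 i ->
    normalized (back i x1) / normalized x1 <= 1.
  move=> Gb xy; have gb := normalized_gt0 _ Gb.
  rewrite ler_pdivrMr // mul1r -ler_ln ?posrE //.
  have := maxF (back i x1, y1) (conj Gb Gy); rewrite /F /lg /=.
  by have := ler_wpM2l K0 (l1dist_backl _ _ _ xy); lra.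
have backy i : G (back i y1) -> h <= y1 ord0 i - x1 ord0 i ->
    1 <= normalized (back i y1) / normalized y1.
  move=> Gb xy; have gb := normalized_gt0 _ Gb.
  rewrite ler_pdivlMr // mul1r -ler_ln ?posrE //.
  have := maxF (x1, back i y1) (conj Gx Gb); rewrite /F /lg /=.
  have := ler_wpM2l K0 (l1dist_backl _ _ _ xy).
  by rewrite l1distC [l1dist y1 x1]l1distC; lra.
have slopes i : slope i y1 <= slope i x1.
  have hV : 0 <= h^-1 by rewrite invr_ge0 ltW.
  have [[xh _]|[xh Gbx]] := pos_grid_back h h0 x1 i Gx;
    have [[yh _]|[yh Gby]] := pos_grid_back h h0 y1 i Gy.
  - by rewrite !slope_first.
  - rewrite (slope_first x1) // slope_next // gerDl pmulr_lle0 ?invr_gt0 //.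
    rewrite pmulr_rle0 ?subr_gt0 // subr_le0 backy //.
    by apply: grid_gap => //; rewrite xh.
  - rewrite (slope_first y1) // slope_next // lerDl pmulr_lge0 ?invr_gt0 //.
    rewrite pmulr_rge0 ?subr_gt0 // subr_ge0 backx //.
    by apply: grid_gap => //; rewrite yh.
  rewrite !slope_next // lerD2l ler_wpM2r //.
  set rx := normalized (back i x1) / _; set ry := normalized (back i y1) / _.
  have rxy : rx <= ry.
    have gbx := normalized_gt0 _ Gbx; have gby := normalized_gt0 _ Gby.
    have px : rx \is Num.pos by rewrite posrE divr_gt0.
    have py : ry \is Num.pos by rewrite posrE divr_gt0.
    have ex : ln rx = lg (back i x1) - lg x1 by rewrite ln_div ?posrE.
    have ey : ln ry = lg (back i y1) - lg y1 by rewrite ln_div ?posrE.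
    rewrite -(ler_ln px py) ex ey.
    have := maxF (back i x1, back i y1) (conj Gbx Gby).
    by rewrite /F /= l1dist_back2; lra.
  have [xy|xy|->] := ltgtP (x1 ord0 i) (y1 ord0 i).
  - have r1 : 1 <= ry by apply: backy => //; exact: grid_gap.
    have p1 : 0 <= (y1 ord0 i - x1 ord0 i) * (ry - 1).
      by rewrite mulr_ge0 ?subr_ge0 // ltW.
    have p2 : 0 <= (x1 ord0 i - h) * (ry - rx).
      by rewrite mulr_ge0 ?subr_ge0 // ltW.
    by lra.
  - have r1 : rx <= 1 by apply: backx => //; exact: grid_gap.
    have p1 : 0 <= (x1 ord0 i - y1 ord0 i) * (1 - rx).
      by rewrite mulr_ge0 ?subr_ge0 // ltW.
    have p2 : 0 <= (y1 ord0 i - h) * (ry - rx).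
      by rewrite mulr_ge0 ?subr_ge0 // ltW.
    by lra.
  - by rewrite ler_wpM2l ?subr_ge0 ?(ltW yh) // lerB.
have : lg x1 - lg y1 <= ln (f x1) - ln (f y1).
  rewrite -(normalized_prod_slope x1) // -(normalized_prod_slope y1) //.
  have px : 0 < \prod_i slope i x1 by apply: prodr_gt0 => i _; exact: slope_gt0.
  have py : 0 < \prod_i slope i y1 by apply: prodr_gt0 => i _; exact: slope_gt0.
  rewrite [ln (normalized x1 * _)]lnM ?posrE //.
  rewrite [ln (normalized y1 * _)]lnM ?posrE // -/(lg x1) -/(lg y1).
  suff : ln (\prod_i slope i y1) <= ln (\prod_i slope i x1) by lra.
  rewrite ler_ln ?posrE //; apply: ler_prod => i _.
  by rewrite slopes ltW // slope_gt0.
by have := ln_f_lipschitz _ _ cx cy; rewrite /F /=; lra.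
Qed.

End Scheme.

(** * The viscosity inequalities in logarithmic form *)

Section LogForm.
Context {R : realType} {n : nat}.
Implicit Types (x y : 'rV[R]_n) (f u : 'rV[R]_n -> R).
Hypothesis hn : (0 < n)%N.
Let n0 : 0 < n%:R :> R. Proof. by rewrite ltr0n. Qed.

(** The counterpart for [u] of the normalized grid function: [(u / n) ^ n]
    divided by the volume. *)
Definition unormalized u x : R := (u x / n%:R) ^+ n / vol x.

Lemma unormalized_gt0 u x : pos_cube x -> 0 < u x -> 0 < unormalized u x.
Proof. by move=> px ux; rewrite divr_gt0 ?exprn_gt0 ?divr_gt0 ?vol_gt0. Qed.

Lemma ln_unormalized u x : pos_cube x -> 0 < u x ->
  ln (unormalized u x) =
  n%:R * ln (u x) - n%:R * ln n%:R - \sum_i ln (x ord0 i).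
Proof.
move=> px ux; have vx := vol_gt0 _ px.
rewrite ln_div ?posrE ?exprn_gt0 ?divr_gt0 // lnXn ?divr_gt0 // ln_div ?posrE //.
by rewrite ln_vol // -[(_ - _) *+ n]mulr_natl mulrBr.
Qed.

Lemma unormalized_slopes u x (c : R) (p : 'I_n -> R) : pos_cube x -> 0 < u x ->
  \prod_i pos_part (u x * (c / n%:R / x ord0 i + p i / n%:R)) =
  unormalized u x * \prod_i pos_part (c + x ord0 i * p i).
Proof.
move=> px ux.
rewrite (eq_bigr (fun i => u x / n%:R / x ord0 i * pos_part (c + x ord0 i * p i))).
  by rewrite big_split /= prodf_div big_const_ord iter_mulr_1.
move=> i _; have /andP[xi _] := px i.
have k0 : 0 <= u x / n%:R / x ord0 i by rewrite !divr_ge0 // ltW.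
rewrite /pos_part [in RHS]maxr_pMr // mulr0; congr Num.max.
by field; rewrite !gt_eqF.
Qed.

(** The volume in the denominator contributes 1 to the coefficient of each
    [ln y_i]: this is why [c] in the slopes goes with [c - 1] in the touching
    condition. *)
Lemma viscosity_super_ln f u y0 (c b : R) (p : 'I_n -> R) :
  viscosity_solution f u -> (forall y, pos_cube y -> 0 < u y) ->
  pos_cube y0 -> 0 <= c ->
  (forall y, pos_cube y -> ln (unormalized u y0) +
      \sum_i ((c - 1) * (ln (y ord0 i) - ln (y0 ord0 i))
             + p i * (y ord0 i - y0 ord0 i) - b * (y ord0 i - y0 ord0 i) ^+ 2)
      <= ln (unormalized u y)) ->
  f y0 <= unormalized u y0 * \prod_i pos_part (c + y0 ord0 i * p i).
Proof.
move=> vu u0 py0 c0 H; have uy0 := u0 _ py0.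
rewrite -unormalized_slopes //.
apply: (viscosity_super_exp f u y0 (u y0) (c / n%:R) (b / n%:R)) => //.
- exact: ltW.
- by rewrite divr_ge0 // ltW.
move=> y py; have uy := u0 _ py.
rewrite mulrBr mulr1 addrC subrK -ler_pdivlMl //.
rewrite -[leRHS]lnK ?posrE ?mulr_gt0 ?invr_gt0 // ler_expR.
rewrite lnM ?lnV ?posrE ?invr_gt0 // -(ler_pM2l n0) mulr_sumr.
have := H y py; rewrite !ln_unormalized //.
rewrite (_ : \sum_i ((c - 1) * (ln (y ord0 i) - ln (y0 ord0 i))
    + p i * (y ord0 i - y0 ord0 i) - b * (y ord0 i - y0 ord0 i) ^+ 2) =
   \sum_i n%:R * (c / n%:R * (ln (y ord0 i) - ln (y0 ord0 i))
    + p i / n%:R * (y ord0 i - y0 ord0 i)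
    - b / n%:R * (y ord0 i - y0 ord0 i) ^+ 2)
   - \sum_i ln (y ord0 i) + \sum_i ln (y0 ord0 i)); first by lra.
rewrite -sumrB -big_split /=; apply: eq_bigr => i _.
by field; rewrite gt_eqF.
Qed.

Lemma viscosity_sub_ln f u y0 (c b : R) (p : 'I_n -> R) :
  viscosity_solution f u -> (forall y, pos_cube y -> 0 < u y) ->
  pos_cube y0 -> 0 <= c ->
  (forall y, pos_cube y -> ln (unormalized u y) <= ln (unormalized u y0) +
      \sum_i ((c - 1) * (ln (y ord0 i) - ln (y0 ord0 i))
             + p i * (y ord0 i - y0 ord0 i) + b * (y ord0 i - y0 ord0 i) ^+ 2)) ->
  unormalized u y0 * \prod_i pos_part (c + y0 ord0 i * p i) <= f y0.
Proof.
move=> vu u0 py0 c0 H; have uy0 := u0 _ py0.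
rewrite -unormalized_slopes //.
apply: (viscosity_sub_exp f u y0 (u y0) (c / n%:R) (b / n%:R)) => //.
- exact: ltW.
- by rewrite divr_ge0 // ltW.
move=> y py; have uy := u0 _ py.
rewrite mulrBr mulr1 addrC subrK -ler_pdivrMl //.
rewrite -[leLHS]lnK ?posrE ?mulr_gt0 ?invr_gt0 // ler_expR.
rewrite lnM ?lnV ?posrE ?invr_gt0 // -(ler_pM2l n0) mulr_sumr.
have := H y py; rewrite !ln_unormalized //.
rewrite (_ : \sum_i ((c - 1) * (ln (y ord0 i) - ln (y0 ord0 i))
    + p i * (y ord0 i - y0 ord0 i) + b * (y ord0 i - y0 ord0 i) ^+ 2) =
   \sum_i n%:R * (c / n%:R * (ln (y ord0 i) - ln (y0 ord0 i))
    + p i / n%:R * (y ord0 i - y0 ord0 i)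
    + b / n%:R * (y ord0 i - y0 ord0 i) ^+ 2)
   - \sum_i ln (y ord0 i) + \sum_i ln (y0 ord0 i)); first by lra.
rewrite -sumrB -big_split /=; apply: eq_bigr => i _.
by field; rewrite gt_eqF.
Qed.

Lemma continuous_ln_sum :
  {within @pos_cube R n, continuous (fun y : 'rV[R]_n => \sum_i ln (y ord0 i))}.
Proof.
apply: continuous_in_subspaceT => y /set_mem py.
apply: (@cvg_big R^o 'I_n +%R 0 xpredT _ _ (nbhs y) (index_enum 'I_n)
  (fun i (y : 'rV[R]_n) => ln (y ord0 i) : R^o)).
  by move=> q; exact: add_continuous.
move=> i _; have yi : 0 < y ord0 i by case/andP: (py i).
exact: (@continuous_comp _ R R (fun y : 'rV[R]_n => y ord0 i) (@ln R) y
  (@coord_continuous R 1 n ord0 i y) (continuous_ln yi)).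
Qed.

Lemma continuous_ln_unormalized f u : viscosity_solution f u ->
  (forall y, pos_cube y -> 0 < u y) ->
  {within pos_cube, continuous (fun y => ln (unormalized u y))}.
Proof.
move=> [uc _ _ _] u0.
have uc' : {within pos_cube, continuous u}.
  by apply: continuous_subspaceW uc => x; exact: pos_cube_cube.
pose w y := n%:R * ln (u y) - n%:R * ln n%:R - \sum_i ln (y ord0 i).
apply: (@subspace_eq_continuous _ _ _ w) => [y /set_mem py|].
  by rewrite /from_subspace /w -ln_unormalized //; exact: u0.
rewrite continuous_subspace_in => y /set_mem py.
apply: (@cvgB R R^o _ (nbhs (y : subspace _))); last exact: continuous_ln_sum.
apply: (@cvgB R R^o _ (nbhs (y : subspace _))); last exact: cvg_cst.
apply: (@cvgM R _ (nbhs (y : subspace _)) _ (cst n%:R)); first exact: cvg_cst.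
have uy := u0 _ py.
exact: (@continuous_comp (subspace pos_cube) R R u (@ln R) y (uc' y)
  (continuous_ln uy)).
Qed.

End LogForm.

(** * Doubling of variables between the grid and the cube *)

Section Doubling.
Context {R : realType} {n : nat}.
Implicit Types (x y : 'rV[R]_n) (F Theta : 'rV[R]_n -> R).

Lemma sqdist_back t i x y :
  sqdist (back t i x) y = sqdist x y - 2 * t * (x ord0 i - y ord0 i) + t ^+ 2.
Proof.
rewrite /sqdist (bigD1 i) //= [in RHS](bigD1 i) //= back_id.
rewrite (eq_bigr (fun j => (x ord0 j - y ord0 j) ^+ 2)); first by ring.
by move=> j ji; rewrite back_neq.
Qed.

Lemma l1dist_back t i x : l1dist x (back t i x) = `|t|.
Proof.
rewrite /l1dist (bigD1 i) //= back_id big1 => [|j ji]; last first.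
  by rewrite back_neq // subrr normr0.
by rewrite addr0 opprB addrCA subrr addr0.
Qed.

Lemma sqdist_ge0 x y : 0 <= sqdist x y.
Proof. by apply: sumr_ge0 => i _; exact: sqr_ge0. Qed.

Lemma sqdistxx x : sqdist x x = 0.
Proof. by rewrite /sqdist big1 // => i _; rewrite subrr expr0n. Qed.

Lemma continuous_sqdist x : continuous (sqdist x).
Proof.
move=> y.
apply: (@cvg_big R^o 'I_n +%R 0 xpredT _ _ (nbhs y) (index_enum 'I_n)
  (fun i (y : 'rV[R]_n) => (x ord0 i - y ord0 i) ^+ 2 : R^o)).
  by move=> q; exact: add_continuous.
move=> i _.
have H : (x ord0 i - z ord0 i) @[z --> y] --> (x ord0 i - y ord0 i).
  apply: (@cvgB R R^o _ (nbhs y) _ (cst (x ord0 i))); first exact: cvg_cst.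
  exact: (@coord_continuous R 1 n ord0 i y).
by under eq_cvg do rewrite expr2; rewrite expr2; exact: (@cvgM R _ (nbhs y)).
Qed.

(** The logarithmic term keeps the continuous variable away from the faces
    where the normalized functions may fail to be continuous. *)
Lemma penalized_max_fiber Theta (B kappa r : R) x :
  0 < kappa -> 0 < r -> pos_cube x ->
  {within pos_cube, continuous Theta} ->
  (forall y, pos_cube y -> `|Theta y| <= B) ->
  let Psi y := Theta y - sqdist x y / (2 * r) + kappa * \sum_i ln (y ord0 i) in
  exists2 y, pos_cube y & forall z, pos_cube z -> Psi z <= Psi y.
Proof.
move=> k0 r0 px cT TB Psi.
have B0 : 0 <= B by apply: le_trans (TB x px).
have lnle0 z : pos_cube z -> forall i, ln (z ord0 i) <= 0.
  by move=> pz i; apply: ln_le0; case/andP: (pz i).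
(* Where a coordinate is smaller than [eta], the logarithmic term alone makes
   [Psi] smaller than its value at [x]. *)
pose eta := expR (\sum_i ln (x ord0 i) - 2 * B / kappa).
pose box : set 'rV[R]_n := [set y | forall i, eta <= y ord0 i <= 1].
have eta0 : 0 < eta by exact: expR_gt0.
have boxpos y : box y -> pos_cube y.
  by move=> by_ i; have /andP[a ->] := by_ i; rewrite andbT (lt_le_trans eta0).
have boxx : box x.
  move=> i; have /andP[xi ->] := px i; rewrite andbT -[leRHS]lnK ?posrE //.
  rewrite ler_expR (bigD1 i) //= -addrA gerDl subr_le0.
  apply: le_trans (_ : 0 <= _); last by rewrite !mulr_ge0 ?invr_ge0 // ltW.
  by apply: sumr_le0 => j _; exact: lnle0.
have cPsi : {within box, continuous Psi}.
  have s : box `<=` pos_cube by [].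
  move=> y; apply: (@cvgD R R^o _ (nbhs (y : subspace box))).
    apply: (@cvgB R R^o _ (nbhs (y : subspace box))).
      exact: (continuous_subspaceW s cT).
    apply: (@cvgM R _ (nbhs (y : subspace box)) _ _ (cst (2 * r)^-1)).
      exact: (continuous_subspaceT (continuous_sqdist x)).
    exact: cvg_cst.
  apply: (@cvgM R _ (nbhs (y : subspace box)) _ (cst kappa)).
    exact: cvg_cst.
  exact: (continuous_subspaceW s continuous_ln_sum).
have box0 : box !=set0 by exists x.
have [y /set_mem boxy maxy] := compact_EVT_max box0 (compact_box eta 1) cPsi.
exists y; first exact: boxpos.
move=> z pz; have [bz|nbz] := pselect (box z); first exact/maxy/mem_set.
apply: le_trans (maxy x (mem_set boxx)).
have [i zi] : exists i, z ord0 i < eta.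
  apply: contrapT => H; apply: nbz => i; have /andP[_ ->] := pz i.
  by rewrite andbT leNgt; apply/negP => zi; apply: H; exists i.
have zi0 : 0 < z ord0 i by case/andP: (pz i).
have lz : \sum_j ln (z ord0 j) <= \sum_i ln (x ord0 i) - 2 * B / kappa.
  apply: le_trans (_ : ln (z ord0 i) <= _).
    rewrite (bigD1 i) //= gerDl; apply: sumr_le0 => j _; exact: lnle0.
  by rewrite -[leRHS]expRK ler_ln ?posrE // ltW.
have := ler_wpM2l (ltW k0) lz; rewrite mulrBr [X in _ - X]mulrC divfK ?gt_eqF //.
rewrite /Psi sqdistxx mul0r subr0.
have : 0 <= sqdist x z / (2 * r) by rewrite divr_ge0 ?sqdist_ge0 // mulr_ge0 // ltW.
have := TB z pz; have := TB x px; rewrite !ler_norml => /andP[? ?] /andP[? ?].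
by lra.
Qed.

Variable h : R.
Hypothesis h0 : 0 < h.

(** The grid is finite, so only the continuous variable needs compactness. *)
Lemma penalized_max F Theta (B kappa r : R) :
  0 < kappa -> 0 < r -> (pos_grid h : set 'rV[R]_n) !=set0 ->
  {within pos_cube, continuous Theta} ->
  (forall y, pos_cube y -> `|Theta y| <= B) ->
  let Psi x y := F x + Theta y - sqdist x y / (2 * r)
                 + kappa * \sum_i ln (y ord0 i) in
  exists x y, [/\ pos_grid h x, pos_cube y & forall x' y',
    pos_grid h x' -> pos_cube y' -> Psi x' y' <= Psi x y].
Proof.
move=> k0 r0 G0 cT TB Psi.
have [Y HY] : {Y : 'rV[R]_n -> 'rV[R]_n & forall x, pos_grid h x ->
    pos_cube (Y x) /\ forall z, pos_cube z -> Psi x z <= Psi x (Y x)}.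
  apply: (@choice _ _ (fun x y => pos_grid h x ->
    pos_cube y /\ forall z, pos_cube z -> Psi x z <= Psi x y)) => x.
  have [Gx|nGx] := pselect (pos_grid h x); last by exists x.
  have [y py maxy] := penalized_max_fiber Theta B kappa r x k0 r0 Gx.1 cT TB.
  by exists y => _; split=> // z /maxy; rewrite /Psi -!addrA lerD2l.
have [x Gx maxx] := pos_grid_argmax h h0 (fun x => Psi x (Y x)) G0.
exists x, (Y x); split=> //; first by have [] := HY x Gx.
move=> x' y' Gx' py'; have [_ /(_ _ py') H] := HY x' Gx'.
by apply: le_trans H _; exact: maxx.
Qed.

(** A quadratic penalty pulls the grid variable away from the other one by at
    most its Lipschitz constant: move one coordinate by one grid step towards
    the other point, unless this leaves the grid, in which case the two
    coordinates are already within one step. *)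
Lemma penalized_displacement F (K r : R) x y :
  0 <= K -> 0 < r -> r <= 1 -> r ^+ 2 = h ->
  pos_grid h x -> pos_cube y ->
  (forall x', pos_grid h x' -> F x - F x' <= K * l1dist x x') ->
  (forall x', pos_grid h x' ->
     F x' - sqdist x' y / (2 * r) <= F x - sqdist x y / (2 * r)) ->
  forall i, `|x ord0 i - y ord0 i| <= (K + 1) * r.
Proof.
move=> K0 r0 r1 rh Gx py FK Fmax i; have hp := h0.
have step t : pos_grid h (back t i x) ->
    2 * t * (x ord0 i - y ord0 i) <= t ^+ 2 + 2 * r * (K * `|t|).
  move=> Gb; have := FK _ Gb; have := Fmax _ Gb.
  rewrite l1dist_back sqdist_back => a b.
  have := lerD a b; rewrite -(@ler_pM2l _ (2 * r)) ?mulr_gt0 // => c.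
  have e s : 2 * r * (s / (2 * r)) = s by rewrite mulrC divfK // mulf_neq0 ?gt_eqF.
  rewrite !mulrDr !mulrN !e in c; lra.
have hr : h <= r by rewrite -rh expr2 ler_piMr // ltW.
have Kr : 0 <= K * r by rewrite mulr_ge0 // ltW.
have yi := py i; have /andP[yi0 yi1] := py i; have /andP[xi0 xi1] := Gx.1 i.
rewrite ler_norml; apply/andP; split; last first.
  have [[xh _]|[_ Gb]] := pos_grid_back h h0 x i Gx; first by lra.
  have := step h Gb; rewrite ger0_norm ?(ltW h0) // => H.
  have : h * (2 * (x ord0 i - y ord0 i)) <= h * (h + 2 * r * K) by lra.
  by rewrite ler_pM2l //; lra.
have [xh|xh] := leP (x ord0 i + h) 1; last by lra.
(* A step back of length [- h] is a step forward. *)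
have Gb : pos_grid h (back (- h) i x).
  split=> j.
    rewrite backE; case: eqP => [->|_]; last by rewrite subr0; exact: Gx.1.
    by apply/andP; split; lra.
  have [k xk] := Gx.2 j; rewrite backE xk; case: eqP => _.
    by exists (k + 1); rewrite rmorphD /= mulrDr mulr1 opprK.
  by exists k; rewrite subr0.
have := step _ Gb; rewrite normrN ger0_norm ?(ltW h0) // sqrrN => H.
have : h * (2 * (y ord0 i - x ord0 i)) <= h * (h + 2 * r * K) by lra.
by rewrite ler_pM2l //; lra.
Qed.

End Doubling.

Section Comparison.
Context {R : realType} {n : nat}.

Lemma expRN_le (t : R) : `|t| <= 1 / 2 -> expR (- t) <= 1 - t + 2 * t ^+ 2.
Proof.
rewrite ler_norml => /andP[t1 t2]; rewrite expRN.
have p : 0 < 1 + t by lra.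
apply: le_trans (_ : (1 + t)^-1 <= _).
  by rewrite lef_pV2 ?posrE ?expR_gt0 // expR_ge1Dx.
rewrite -[leLHS]mul1r ler_pdivrMr // -subr_ge0.
have -> : (1 - t + 2 * t ^+ 2) * (1 + t) - 1 = t ^+ 2 * (1 + 2 * t) by ring.
by rewrite mulr_ge0 ?sqr_ge0 //; lra.
Qed.

(** If the factors agree up to [e] and the reference factors are bounded above,
    while their product is bounded below, then each of them is bounded below,
    so that the additive error is a relative one. *)
Lemma compare_products (alpha beta : 'I_n -> R) (g1 g2 f1 f2 m M B e : R) :
  0 < m -> 0 < M -> 1 <= B -> 0 < g1 -> 0 < g2 -> 0 < f1 -> 0 < f2 ->
  g2 <= M -> m <= f2 -> 0 <= e ->
  (forall i, 0 < beta i <= B) -> (forall i, beta i - e <= alpha i) ->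
  g1 * \prod_i pos_part (alpha i) <= f1 ->
  f2 <= g2 * \prod_i beta i ->
  let c := m / M / B ^+ n in
  e / c < 1 / 2 ->
  ln g1 - ln g2 <= ln f1 - ln f2 + 2 * n%:R * (e / c).
Proof.
move=> m0 M0 B1 g10 g20 f10 f20 g2M mf2 e0 betaB ab H1 H2 c.
set s := e / c => s2.
have B0 : 0 < B by lra.
have c0 : 0 < c by rewrite !divr_gt0 // exprn_gt0.
have s0 : 0 <= s by rewrite divr_ge0 // ltW.
have pb : 0 < \prod_i beta i by apply: prodr_gt0 => i _; case/andP: (betaB i).
have bc i : c <= beta i.
  rewrite /c ler_pdivrMr ?exprn_gt0 //.
  apply: le_trans (_ : \prod_i beta i <= _).
    rewrite ler_pdivrMr // mulrC; apply: le_trans mf2 (le_trans H2 _).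
    by rewrite ler_wpM2r // ltW.
  rewrite (bigD1 i) //=; apply: ler_wpM2l; first by case/andP: (betaB i) => /ltW.
  apply: le_trans (_ : \prod_(j < n | j != i) B <= _).
    by apply: ler_prod => j _; case/andP: (betaB j) => /ltW -> ->.
  apply: le_trans (_ : \prod_(j < n) B <= _).
    rewrite [leRHS](bigD1 i) //= ler_peMl //.
    by apply: prodr_ge0 => j _; exact: ltW.
  by rewrite big_const_ord iter_mulr_1.
have ab' i : 0 <= beta i * (1 - s) <= pos_part (alpha i).
  have /andP[b0 _] := betaB i.
  apply/andP; split; first by rewrite mulr_ge0 ?(ltW b0) //; lra.
  rewrite /pos_part le_max; apply/orP; left; apply: le_trans (ab i).
  rewrite mulrBr mulr1 lerD2l lerN2 -[leLHS](@divfK _ c) ?gt_eqF //.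
  by rewrite -/s mulrC ler_wpM2r.
have H3 : g1 * ((\prod_i beta i) * (1 - s) ^+ n) <= f1.
  apply: le_trans H1; apply: ler_wpM2l; first exact: ltW.
  rewrite -[X in _ * X](_ : \prod_(i < n) (1 - s) = _); last first.
    by rewrite big_const_ord iter_mulr_1.
  by rewrite -big_split /=; apply: ler_prod => i _; exact: ab'.
have s1 : 0 < 1 - s by lra.
have l1 : ln g1 + (ln (\prod_i beta i) + n%:R * ln (1 - s)) <= ln f1.
  rewrite mulr_natl -lnXn // -lnM ?posrE ?exprn_gt0 // -lnM ?posrE //.
    by rewrite ler_ln ?posrE // !mulr_gt0 // exprn_gt0.
  by rewrite mulr_gt0 // exprn_gt0.
have l2 : ln f2 <= ln g2 + ln (\prod_i beta i).
  by rewrite -lnM ?posrE // ler_ln ?posrE // mulr_gt0.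
have l3 : - (2 * s) <= ln (1 - s).
  have : 1 / 2 < 1 - s by lra.
  move/(ln_ge_tangent _ _ ltr01); rewrite ln1 subr0 expr1n !divr1 => H.
  have : s * s <= s * (1 / 2) by rewrite ler_wpM2l // ltW.
  by move=> ss; apply: le_trans H; rewrite expr2; lra.
have := ler_wpM2l (ler0n R n) l3; lra.
Qed.

End Comparison.

(** * The ratio of the two normalized solutions *)

Section LogRatio.
Context {R : realType} {n : nat}.
Implicit Types (x y z : 'rV[R]_n).

Lemma prod_pos_part_gt0 (b : 'I_n -> R) :
  0 < \prod_i pos_part (b i) -> forall i, 0 < b i.
Proof.
move=> H i; have : \prod_i pos_part (b i) != 0 by rewrite gt_eqF.
by move/prodf_neq0 => /(_ i isT); rewrite /pos_part; case: ltP => //; rewrite eqxx.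
Qed.

Lemma ler_ratio_expR (a b t : R) : 0 < a -> 0 < b ->
  (a / b <= expR t) = (ln a - ln b <= t).
Proof.
by move=> a0 b0; rewrite -{1}[a / b]lnK ?posrE ?divr_gt0 // ler_expR ln_div ?posrE.
Qed.

Lemma ger_ratio_expR (a b t : R) : 0 < a -> 0 < b ->
  (expR t <= a / b) = (t <= ln a - ln b).
Proof.
by move=> a0 b0; rewrite -{1}[a / b]lnK ?posrE ?divr_gt0 // ler_expR ln_div ?posrE.
Qed.

Lemma sum_ln_le0 x : pos_cube x -> \sum_i ln (x ord0 i) <= 0.
Proof.
by move=> px; apply: sumr_le0 => i _; apply: ln_le0; case/andP: (px i).
Qed.

Lemma penalty_increment (kappa r : R) x y z : 0 < r ->
  \sum_i (kappa * (ln (z ord0 i) - ln (y ord0 i))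
          + (x ord0 i - y ord0 i) / r * (z ord0 i - y ord0 i)
          - 1 / (2 * r) * (z ord0 i - y ord0 i) ^+ 2) =
  kappa * (\sum_i ln (z ord0 i) - \sum_i ln (y ord0 i))
  - (sqdist x z / (2 * r) - sqdist x y / (2 * r)).
Proof.
move=> r0; rewrite /sqdist !mulr_suml -!sumrB mulr_sumr -sumrB.
by apply: eq_bigr => i _; field; rewrite gt_eqF.
Qed.

Variables (f v u : 'rV[R]_n -> R) (h r m M L : R).
Hypothesis hn : (0 < n)%N.
Hypothesis h0 : 0 < h.
Hypothesis r0 : 0 < r.
Hypothesis r1 : r <= 1.
Hypothesis rh : r ^+ 2 = h.
Hypothesis sv : maximal_scheme_solution h f v.
Hypothesis vu : viscosity_solution f u.
Hypothesis m0 : 0 < m.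
Hypothesis mfM : forall x, cube x -> m <= f x <= M.
Hypothesis L0 : 0 <= L.
Hypothesis fL : forall x y, cube x -> cube y -> `|f x - f y| <= L * l1dist x y.

Let f0 x : cube x -> 0 < f x.
Proof. by move=> /mfM /andP[mf _]; exact: lt_le_trans mf. Qed.

Local Notation G := (pos_grid h).
Local Notation g := (normalized v).
Local Notation gu := (unormalized u).

(** The penalty has gradient at most [grad_bound]; a slope differs by at most
    [slope_error * r] from the value that the penalty predicts; and each factor
    of the equation is at least [slope_floor], because all of them are at most
    [grad_bound + 2] while their product is at least [m / (2 * M)]. *)
Definition grad_bound : R := L / m + 1.
Definition slope_error : R := 2 + grad_bound + 2 * (grad_bound + 1) ^+ 2.
Definition slope_floor : R := m / (2 * M) / (grad_bound + 2) ^+ n.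

Local Notation P := grad_bound.
Local Notation C1 := slope_error.
Local Notation c0 := slope_floor.

Let K0 : 0 <= L / m. Proof. by rewrite divr_ge0 // ltW. Qed.
Let P1 : 1 <= P. Proof. by have := K0; rewrite /P; lra. Qed.
Let hr : h <= r. Proof. by rewrite -rh expr2 ler_piMr // ltW. Qed.

Let C1P : 2 + P + 2 * (P + 1) <= C1.
Proof.
have := P1; rewrite /C1 => p1; rewrite lerD2l ler_pM2l // expr2 ler_peMr //; lra.
Qed.

(** Consistency of the scheme: at a maximum of the doubled function the
    difference quotient of [ln (normalized v)] in direction [i] is [p] up to
    [O(h / r) = O(r)], and linearizing the exponential costs another [O(h)]. *)
Lemma slope_lower x i (p : R) : G x -> r * (P + 1) <= 1 / 2 -> `|p| <= P ->
  (G (back h i x) -> ln (g (back h i x)) - ln (g x) <= - (h * (p - r / 2))) ->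
  1 + x ord0 i * p - r * (C1 - 1) <= slope v h i x.
Proof.
move=> Gx rP; rewrite ler_norml => /andP[pl pu] H.
have [p1 hp rp hr' rr] : [/\ 1 <= P, 0 < h, 0 < r, h <= r & r <= 1] by [].
have hpP : h * p <= r * P.
  apply: le_trans (_ : h * P <= _); first by rewrite ler_wpM2l // ltW.
  by rewrite ler_wpM2r //; lra.
have sq0 : 0 <= r * (P + 1) ^+ 2 by rewrite mulr_ge0 ?sqr_ge0 // ltW.
have [[xh _]|[xh Gb]] := pos_grid_back h h0 x i Gx.
  rewrite (slope_first f) // xh /C1; lra.
rewrite (slope_next f) //.
set t := h * (p - r / 2) in H.
have t2 : `|t| <= h * (P + 1).
  rewrite /t normrM gtr0_norm // ler_wpM2l ?(ltW hp) //.
  by rewrite ler_norml; apply/andP; split; lra.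
have hP : h * (P + 1) <= r * (P + 1) by rewrite ler_wpM2r //; lra.
have tt : `|t| <= 1 / 2 by lra.
have gx := normalized_gt0 f v h hn h0 f0 sv x Gx.
have gb := normalized_gt0 f v h hn h0 f0 sv _ Gb.
have rho : g (back h i x) / g x <= 1 - t + 2 * t ^+ 2.
  by apply: le_trans (expRN_le _ tt); rewrite ler_ratio_expR //; exact: H.
have t3 : t ^+ 2 <= h * r * (P + 1) ^+ 2.
  rewrite -real_normK ?num_real //; apply: le_trans (_ : (h * (P + 1)) ^+ 2 <= _).
    by rewrite lerXn2r ?nnegrE //; apply: le_trans t2.
  by rewrite exprMn expr2 ler_wpM2r ?sqr_ge0 // ler_wpM2l // ltW.
move: rho; set q := _ / g x => rho.
have q1 : p - r * (1 / 2 + 2 * (P + 1) ^+ 2) <= (1 - q) / h.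
  by rewrite ler_pdivlMr //; move: rho t3; rewrite /t; lra.
have xi1 : x ord0 i <= 1 by case/andP: (Gx.1 i).
rewrite -mulrA; apply: le_trans (_ : 1 + (x ord0 i - h) *
    (p - r * (1 / 2 + 2 * (P + 1) ^+ 2)) <= _); last first.
  by rewrite lerD2l ler_wpM2l // subr_ge0 ltW.
have E0 : 0 <= r * (1 / 2 + 2 * (P + 1) ^+ 2) by lra.
have : (x ord0 i - h) * (r * (1 / 2 + 2 * (P + 1) ^+ 2)) <=
       1 * (r * (1 / 2 + 2 * (P + 1) ^+ 2)) by rewrite ler_wpM2r //; lra.
rewrite /C1; lra.
Qed.

Lemma slope_upper x i (p : R) : G x -> `|p| <= P ->
  (G (back h i x) -> ln (g x) - ln (g (back h i x)) <= h * (p + r / 2)) ->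
  slope v h i x <= 1 + x ord0 i * p + r * (P + 1).
Proof.
move=> Gx; rewrite ler_norml => /andP[pl pu] H.
have [p1 hp rp hr' rr] : [/\ 1 <= P, 0 < h, 0 < r, h <= r & r <= 1] by [].
have hpP : - (r * P) <= h * p.
  apply: le_trans (_ : h * - P <= _); last by rewrite ler_wpM2l // ltW.
  by rewrite mulrN lerN2 ler_wpM2r //; lra.
have [[xh _]|[xh Gb]] := pos_grid_back h h0 x i Gx.
  by rewrite (slope_first f) // xh; lra.
rewrite (slope_next f) //.
have gx := normalized_gt0 f v h hn h0 f0 sv x Gx.
have gb := normalized_gt0 f v h hn h0 f0 sv _ Gb.
have rho : 1 - h * (p + r / 2) <= g (back h i x) / g x.
  apply: le_trans (expR_ge1Dx _) _; rewrite ger_ratio_expR //.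
  by have := H Gb; lra.
move: rho; set q := _ / g x => rho.
have q1 : (1 - q) / h <= p + r / 2 by rewrite ler_pdivrMr //; lra.
have xi1 : x ord0 i <= 1 by case/andP: (Gx.1 i).
rewrite -mulrA; apply: le_trans (_ : 1 + (x ord0 i - h) * (p + r / 2) <= _).
  by rewrite lerD2l ler_wpM2l // subr_ge0 ltW.
have : (x ord0 i - h) * r <= 1 * r by rewrite ler_wpM2r //; lra.
lra.
Qed.

Let ubounds x : pos_cube x -> 0 < u x /\ m / 2 <= gu x <= 2 * M.
Proof.
move=> px; have [ux /andP[lo hi]] := u_bounds hn f u m M vu m0 mfM x px.
have vx := vol_gt0 _ px.
by split=> //; rewrite ler_pdivlMr // ler_pdivrMr // lo hi.
Qed.

Let M0 : 0 < M.
Proof.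
have /andP[a b] := mfM _ cube_const1; exact: lt_le_trans m0 (le_trans a b).
Qed.

Let ln_gu_bounded y : pos_cube y ->
  `|ln (gu y)| <= `|ln (m / 2)| + `|ln (2 * M)|.
Proof.
move=> py; have [uy /andP[lo hi]] := ubounds _ py.
have m20 : 0 < m / 2 by have := m0; lra.
have M20 : 0 < 2 * M by have := M0; lra.
have gy := unormalized_gt0 hn u y py uy.
have a : ln (m / 2) <= ln (gu y) by rewrite ler_ln ?posrE.
have b : ln (gu y) <= ln (2 * M) by rewrite ler_ln ?posrE.
have := ler_norm (ln (2 * M)); have := ler_norm (- ln (m / 2)); rewrite normrN.
have := normr_ge0 (ln (2 * M)); have := normr_ge0 (ln (m / 2)).
by rewrite ler_norml => *; apply/andP; split; lra.
Qed.

Definition log_rate : R := L / m * (n%:R * P) + 2 * n%:R * (C1 / c0).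

Let ln_f_diff x y : cube x -> cube y -> (forall i, `|x ord0 i - y ord0 i| <= P * r) ->
  ln (f x) - ln (f y) <= L / m * (n%:R * P) * r.
Proof.
move=> cx cy xy; apply: le_trans (ln_f_lipschitz f f0 m M m0 mfM L fL x y cx cy) _.
rewrite -[leRHS]mulrA; apply: ler_wpM2l; first exact: K0.
apply: le_trans (_ : \sum_(i < n) P * r <= _); first exact: ler_sum.
by rewrite sumr_const card_ord -[leLHS]mulr_natl mulrA.
Qed.

Hypothesis small : C1 * r / c0 < 1 / 2.

Let B0 : 1 <= P + 2. Proof. by have := P1; lra. Qed.

Let c0_gt0 : 0 < c0.
Proof. by rewrite !divr_gt0 ?exprn_gt0 ?mulr_gt0 //; have := P1; lra. Qed.

Let rP_small : r * (P + 1) <= 1 / 2.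
Proof.
have c1 : c0 <= 1.
  have /andP[a b] := mfM _ cube_const1; have mM := le_trans a b.
  have MM : 0 < 2 * M by have := M0; lra.
  have e1 : 1 <= (P + 2) ^+ n by rewrite exprn_ege1.
  rewrite /c0 ler_pdivrMr; last exact: lt_le_trans ltr01 e1.
  rewrite mul1r; apply: le_trans e1; rewrite ler_pdivrMr // mul1r.
  by have := M0; lra.
apply: le_trans (ltW small); rewrite (ler_pdivlMr _ _ c0_gt0).
have := C1P; have := P1; have rp := r0 => p1 c1p.
apply: le_trans (_ : r * (P + 1) * 1 <= _).
  by rewrite ler_wpM2l // mulr_ge0 ?ltW //; lra.
by rewrite mulr1 [leRHS]mulrC ler_wpM2l ?(ltW rp) //; lra.
Qed.

Let Kdist x x' : G x -> G x' -> ln (g x) - ln (g x') <= L / m * l1dist x x'.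
Proof. exact: (ln_normalized_lipschitz f v h hn h0 f0 sv m M m0 mfM L L0 fL). Qed.

(** At the doubled maximum the penalty yields a subjet of the solution and lower
    bounds for the slopes of the grid function that agree up to
    [slope_error * r]; comparing the two equations bounds the maximum of the
    doubled function, and the choice of equal arguments [(x, x)] gives the
    estimate. The sign of [(x_i - y_i) * p_i], with [p] the gradient of the
    penalty, allows to exchange the weights [x_i] and [y_i]. *)
Lemma log_ratio_upper x : G x ->
  ln (g x) - ln (gu x) <= log_rate * r - r * \sum_i ln (x ord0 i).
Proof.
move=> Gx'; have G0 : (G : set 'rV[R]_n) !=set0 by exists x.
have upos y : pos_cube y -> 0 < u y by move=> /ubounds[].
have cT : {within pos_cube, continuous (fun y => - ln (gu y))}.
  by move=> y; apply: (@cvgN R R^o); exact: (continuous_ln_unormalized hn f u vu upos).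
have TB y : pos_cube y -> `|- ln (gu y)| <= `|ln (m / 2)| + `|ln (2 * M)|.
  by move=> py; rewrite normrN; exact: ln_gu_bounded.
have [a [y [Ga py maxP]]] := penalized_max h h0 (fun x => ln (g x)) _ _ r r
  r0 r0 G0 cT TB.
have disp := penalized_displacement h h0 (fun x => ln (g x)) (L / m) r a y K0 r0
  r1 rh Ga py (fun x' Gx' => Kdist a x' Ga Gx').
have {}disp i : `|a ord0 i - y ord0 i| <= P * r.
  apply: disp => x' Gx1; have := maxP x' y Gx1 py; lra.
pose p i := (a ord0 i - y ord0 i) / r.
have pP i : `|p i| <= P.
  by rewrite /p normrM normfV (gtr0_norm r0) ler_pdivrMr.
have [uy /andP[glo ghi]] := ubounds _ py.
have ca := pos_grid_cube _ _ Ga; have cy := pos_cube_cube _ py.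
have ga := normalized_gt0 f v h hn h0 f0 sv a Ga.
have super : f y <= gu y * \prod_i pos_part (1 + r + y ord0 i * p i).
  apply: (viscosity_super_ln hn f u y (1 + r) (1 / (2 * r)) p vu upos py).
    by rewrite addr_ge0 // ltW.
  move=> z pz; rewrite (addrC 1 r) addrK penalty_increment //.
  have := maxP a z Ga pz; lra.
have gy := unormalized_gt0 hn u y py uy.
have bpos : forall i, 0 < 1 + r + y ord0 i * p i.
  apply: prod_pos_part_gt0; rewrite -(pmulr_rgt0 _ gy).
  exact: lt_le_trans (f0 _ cy) super.
have key : ln (g a) - ln (gu y) <= ln (f a) - ln (f y) + 2 * n%:R * (C1 * r / c0).
  apply: (compare_products (fun i => slope v h i a)
    (fun i => 1 + r + y ord0 i * p i)) small => //.
  - by rewrite mulr_gt0.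
  - exact: f0.
  - exact: f0.
  - by have /andP[] := mfM _ cy.
  - by rewrite mulr_ge0 ?(ltW r0) //; have := C1P; have := P1; lra.
  - move=> i; rewrite bpos /=; have := r1; have /andP[yi0 yi1] := py i.
    have : y ord0 i * p i <= 1 * P.
      apply: le_trans (_ : y ord0 i * P <= _).
        by rewrite ler_wpM2l ?(ltW yi0) //; apply: le_trans (ler_norm _) (pP i).
      by rewrite ler_wpM2r //; have := P1; lra.
    by lra.
  - move=> i; have := slope_lower a i (p i) Ga rP_small (pP i).
    have yp : y ord0 i * p i <= a ord0 i * p i.
      rewrite -subr_ge0 -mulrBl /p mulrA -expr2.
      by rewrite divr_ge0 ?sqr_ge0 // ltW.
    move=> H; apply: le_trans (H _); first by lra.
    move=> Gb; have := maxP _ y Gb py.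
    rewrite sqdist_back.
    have -> : (sqdist a y - 2 * h * (a ord0 i - y ord0 i) + h ^+ 2) / (2 * r) =
       sqdist a y / (2 * r) - h * (p i - r / 2).
      by rewrite /p -rh; field; rewrite gt_eqF.
    by lra.
  - rewrite (eq_bigr (fun i => slope v h i a)) => [|i _].
      by rewrite (normalized_prod_slope f).
    by rewrite /pos_part max_l // ltW // (slope_gt0 f v h hn h0 f0 sv).
  - move: super; rewrite (eq_bigr (fun i => 1 + r + y ord0 i * p i)) // => i _.
    by rewrite /pos_part max_l // ltW.
have := maxP x x Gx' Gx'.1; rewrite sqdistxx mul0r.
have := ln_f_diff _ _ ca cy disp.
have : 0 <= sqdist a y / (2 * r).
  by rewrite divr_ge0 ?sqdist_ge0 // mulr_ge0 // ltW.
have : r * \sum_i ln (y ord0 i) <= 0.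
  by rewrite pmulr_rle0 // sum_ln_le0.
rewrite /log_rate; move: key; rewrite [C1 * r / c0]mulrAC; lra.
Qed.

(** The mirror image of [log_ratio_upper]: the penalty yields a superjet of the
    solution and upper bounds for the slopes of the grid function. *)
Lemma log_ratio_lower x : G x ->
  ln (gu x) - ln (g x) <= log_rate * r - r * \sum_i ln (x ord0 i).
Proof.
move=> Gx'; have G0 : (G : set 'rV[R]_n) !=set0 by exists x.
have upos y : pos_cube y -> 0 < u y by move=> /ubounds[].
have cT := continuous_ln_unormalized hn f u vu upos.
have [a [y [Ga py maxP]]] := penalized_max h h0 (fun x => - ln (g x)) _ _ r r
  r0 r0 G0 cT ln_gu_bounded.
have NK x' : G x' -> - ln (g a) - - ln (g x') <= L / m * l1dist a x'.
  by move=> Gx1; rewrite l1distC; have := Kdist x' a Gx1 Ga; lra.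
have disp := penalized_displacement h h0 (fun x => - ln (g x)) (L / m) r a y K0 r0
  r1 rh Ga py NK.
have {}disp i : `|a ord0 i - y ord0 i| <= P * r.
  apply: disp => x' Gx1; have := maxP x' y Gx1 py; lra.
pose p i := (y ord0 i - a ord0 i) / r.
have pP i : `|p i| <= P.
  by rewrite /p normrM normfV (gtr0_norm r0) ler_pdivrMr // distrC.
have [uy /andP[glo ghi]] := ubounds _ py.
have ca := pos_grid_cube _ _ Ga; have cy := pos_cube_cube _ py.
have ga := normalized_gt0 f v h hn h0 f0 sv a Ga.
have sub : gu y * \prod_i pos_part (1 - r + y ord0 i * p i) <= f y.
  apply: (viscosity_sub_ln hn f u y (1 - r) (1 / (2 * r)) p vu upos py).
    by rewrite subr_ge0.
  move=> z pz; have := maxP a z Ga pz; have := penalty_increment r r a y z r0.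
  rewrite (_ : \sum_i ((1 - r - 1) * (ln (z ord0 i) - ln (y ord0 i)) +
       p i * (z ord0 i - y ord0 i) +
       1 / (2 * r) * (z ord0 i - y ord0 i) ^+ 2) = - \sum_i
     (r * (ln (z ord0 i) - ln (y ord0 i))
          + (a ord0 i - y ord0 i) / r * (z ord0 i - y ord0 i)
          - 1 / (2 * r) * (z ord0 i - y ord0 i) ^+ 2)).
    by move=> ->; lra.
  rewrite -sumrN; apply: eq_bigr => i _; rewrite /p; field.
  by rewrite gt_eqF.
have upper i : slope v h i a <= 1 + a ord0 i * p i + r * (P + 1).
  apply: slope_upper => // Gb; have := maxP _ y Gb py; rewrite sqdist_back.
  have -> : (sqdist a y - 2 * h * (a ord0 i - y ord0 i) + h ^+ 2) / (2 * r) =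
       sqdist a y / (2 * r) + h * (p i + r / 2).
    by rewrite /p -rh; field; rewrite gt_eqF.
  by lra.
have gy := unormalized_gt0 hn u y py uy.
have key : ln (gu y) - ln (g a) <= ln (f y) - ln (f a) + 2 * n%:R * (C1 * r / c0).
  apply: (compare_products (fun i => 1 - r + y ord0 i * p i)
    (fun i => slope v h i a)) small => //.
  - by rewrite mulr_gt0.
  - exact: f0.
  - exact: f0.
  - have /andP[_ H] := normalized_bounds f v h hn h0 f0 sv m M mfM a Ga.
    by apply: le_trans H _; have := M0; lra.
  - by have /andP[] := mfM _ ca.
  - by rewrite mulr_ge0 ?(ltW r0) //; have := C1P; have := P1; lra.
  - move=> i; rewrite (slope_gt0 f v h hn h0 f0 sv) //=; apply: le_trans (upper i) _.
    have /andP[ai0 ai1] := Ga.1 i; have := rP_small.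
    have : a ord0 i * p i <= 1 * P.
      apply: le_trans (_ : a ord0 i * P <= _).
        by rewrite ler_wpM2l ?(ltW ai0) //; apply: le_trans (ler_norm _) (pP i).
      by rewrite ler_wpM2r //; have := P1; lra.
    by lra.
  - move=> i; have := upper i.
    have yp : a ord0 i * p i <= y ord0 i * p i.
      rewrite -subr_ge0 -mulrBl /p mulrA -expr2.
      by rewrite divr_ge0 ?sqr_ge0 // ltW.
    have : r * (2 + P + 2 * (P + 1)) <= r * C1 by rewrite ler_wpM2l ?(ltW r0).
    have : 0 <= r * (P + 1).
      by rewrite mulr_ge0 ?(ltW r0) //; have := P1; lra.
    by have := r0; lra.
  by rewrite (normalized_prod_slope f).
have := maxP x x Gx' Gx'.1; rewrite sqdistxx mul0r.
have disp' i : `|y ord0 i - a ord0 i| <= P * r by rewrite distrC.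
have := ln_f_diff _ _ cy ca disp'.
have : 0 <= sqdist a y / (2 * r).
  by rewrite divr_ge0 ?sqdist_ge0 // mulr_ge0 // ltW.
have : r * \sum_i ln (y ord0 i) <= 0.
  by rewrite pmulr_rle0 // sum_ln_le0.
rewrite /log_rate; move: key; rewrite [C1 * r / c0]mulrAC; lra.
Qed.

End LogRatio.

(** * The error estimates *)

Section FinalEstimates.
Context {R : realType} {n : nat}.
Implicit Types (x y z : 'rV[R]_n).

Lemma sub_le_of_ln (a b D : R) : 0 < a -> 0 < b -> ln a - ln b <= D ->
  a - b <= a * D.
Proof.
move=> a0 b0 H; have : expR (- D) <= b / a.
  by rewrite ger_ratio_expR //; lra.
rewrite ler_pdivlMr // => e1.
have := ler_wpM2r (ltW a0) (expR_ge1Dx (- D)); lra.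
Qed.

(** An error of size [- ln x_i] in logarithmic scale is harmless because
    [vol x <= x_i] and [t * - ln t <= 1]. *)
Lemma vol_sum_ln x : pos_cube x -> vol x * - (\sum_i ln (x ord0 i)) <= n%:R.
Proof.
move=> px; rewrite -sumrN mulr_sumr.
apply: le_trans (_ : \sum_(i < n) 1 <= _); last by rewrite sumr_const card_ord.
apply: ler_sum => i _; have /andP[xi0 xi1] := px i.
have l0 : 0 <= - ln (x ord0 i) by rewrite oppr_ge0 ln_le0.
apply: le_trans (_ : x ord0 i * - ln (x ord0 i) <= _).
  by rewrite ler_wpM2r // vol_le_coord //; exact: pos_cube_cube.
have := ln_le_tangent _ _ xi0 ltr01; rewrite ln1 sub0r.
by rewrite ler_pdivlMr //; lra.
Qed.

Lemma rate_signs (m M L : R) : 0 < m -> 0 < M -> 0 <= L ->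
  [/\ 0 < slope_error m L, 0 < slope_floor (n := n) m M L &
      0 <= log_rate (n := n) m M L].
Proof.
move=> m0 M0 L0; have K0 : 0 <= L / m by rewrite divr_ge0 // ltW.
have P0 : 0 < grad_bound m L by rewrite /grad_bound; lra.
have c00 : 0 < slope_floor (n := n) m M L.
  by rewrite !divr_gt0 ?exprn_gt0 ?mulr_gt0 //; lra.
have C10 : 0 < slope_error m L.
  by rewrite /slope_error; have := sqr_ge0 (grad_bound m L + 1); lra.
split=> //; apply: addr_ge0.
  by rewrite mulr_ge0 // mulr_ge0 ?ler0n // ltW.
have : 0 < slope_error m L / slope_floor (n := n) m M L by rewrite divr_gt0.
by move=> /ltW H; apply: mulr_ge0 => //; rewrite mulr_ge0 ?ler0n.
Qed.

(** The last summand covers the steps [h] for which [slope_error * sqrt h] is not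
    small compared with [slope_floor]. *)
Definition grid_rate (m M L : R) : R :=
  2 * M * (log_rate (n := n) m M L + n%:R
           + 2 * (slope_error m L / slope_floor (n := n) m M L)).

Lemma grid_error (f v u : 'rV[R]_n -> R) (h m M L : R) x :
  (0 < n)%N -> 0 < h ->
  maximal_scheme_solution h f v -> viscosity_solution f u ->
  0 < m -> (forall x, cube x -> m <= f x <= M) ->
  0 <= L -> (forall x y, cube x -> cube y -> `|f x - f y| <= L * l1dist x y) ->
  pos_grid h x ->
  `|v x - (u x / n%:R) ^+ n| <= grid_rate m M L * Num.sqrt h.
Proof.
move=> hn h0 sv vu m0 mfM L0 fL Gx.
have f0 y : cube y -> 0 < f y by move=> /mfM /andP[mf _]; exact: lt_le_trans mf.
set r := Num.sqrt h.
have r0 : 0 < r by rewrite sqrtr_gt0.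
have rh : r ^+ 2 = h by rewrite sqr_sqrtr // ltW.
have i0 := Ordinal hn.
have r1 : r <= 1.
  rewrite -(@ler_pXn2r _ 2) ?nnegrE // ?(ltW r0) // rh expr1n.
  apply: le_trans (pos_grid_ge h h0 x i0 Gx) _; by case/andP: (Gx.1 i0).
have px := Gx.1; have cx := pos_cube_cube _ px.
have vx := vol_gt0 _ px; have v1 := vol_le1 _ cx.
have M0 : 0 < M by have /andP[a b] := mfM _ cx; lra.
have [ux /andP[lo hi]] := u_bounds hn f u m M vu m0 mfM x px.
have gx := normalized_gt0 f v h hn h0 f0 sv x Gx.
have /andP[_ gM] := normalized_bounds f v h hn h0 f0 sv m M mfM x Gx.
have gux := unormalized_gt0 hn u x px ux.
have guM : unormalized u x <= 2 * M by rewrite ler_pdivrMr.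
have vE : v x = normalized v x * vol x by rewrite divfK // gt_eqF.
have wE : (u x / n%:R) ^+ n = unormalized u x * vol x by rewrite divfK // gt_eqF.
set C1 := slope_error m L; set c0 := slope_floor (n := n) m M L.
have [C10 c00 lr0] := rate_signs m M L m0 M0 L0.
rewrite -/C1 -/c0 in C10 c00.
have Cc : 0 < C1 / c0 by rewrite divr_gt0.
rewrite vE wE /grid_rate -/C1 -/c0.
(* For large [r] the trivial bound [2 * M] is of order [r] already. *)
have [small|large] := ltP (C1 * r / c0) (1 / 2); last first.
  have e1 : 1 <= 2 * (C1 / c0) * r by move: large; rewrite mulrAC; lra.
  have b1 : 0 <= normalized v x * vol x <= 2 * M.
    rewrite mulr_ge0 ?(ltW gx) ?(ltW vx) //=.
    apply: le_trans (_ : normalized v x * 1 <= _); last by lra.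
    by rewrite ler_wpM2l // ltW.
  have b2 : 0 <= unormalized u x * vol x <= 2 * M.
    rewrite mulr_ge0 ?(ltW gux) ?(ltW vx) //=.
    apply: le_trans (_ : unormalized u x * 1 <= _); last by lra.
    by rewrite ler_wpM2l // ltW.
  apply: le_trans (_ : 2 * M * 1 <= _).
    move: b1 b2 => /andP[? ?] /andP[? ?].
    by rewrite mulr1 ler_norml; apply/andP; split; lra.
  rewrite -[leRHS]mulrA; apply: ler_wpM2l; first by lra.
  apply: le_trans e1 _; rewrite ler_wpM2r ?(ltW r0) //.
  by rewrite lerDr addr_ge0.
have up := log_ratio_upper f v u h r m M L hn h0 r0 r1 rh sv vu m0 mfM L0 fL small x Gx.
have low := log_ratio_lower f v u h r m M L hn h0 r0 r1 rh sv vu m0 mfM L0 fL small x Gx.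
move: up low; set D := _ * r - _ => up low.
have D0 : 0 <= D.
  rewrite /D -mulrN addr_ge0 ?mulr_ge0 ?(ltW r0) // oppr_ge0.
  exact: sum_ln_le0.
have volD : vol x * D <= (log_rate (n := n) m M L + n%:R) * r.
  have a1 := vol_sum_ln x px.
  have a2 : vol x * (log_rate (n := n) m M L * r) <= 1 * (log_rate (n := n) m M L * r).
    by rewrite ler_wpM2r // mulr_ge0 // ltW.
  have := ler_wpM2r (ltW r0) a1; rewrite /D; lra.
have bound a b : 0 < a -> 0 < b -> a <= 2 * M -> ln a - ln b <= D ->
    a * vol x - b * vol x <= 2 * M * (log_rate (n := n) m M L + n%:R + 2 * (C1 / c0)) * r.
  move=> a0 b0 aM H; rewrite -mulrBl.
  apply: le_trans (_ : a * D * vol x <= _).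
    by rewrite ler_wpM2r ?(ltW vx) // sub_le_of_ln.
  rewrite -mulrA (mulrC D) -[leRHS]mulrA.
  apply: ler_pM => //; [exact: ltW| by rewrite mulr_ge0 // ltW |].
  apply: le_trans volD _; rewrite ler_wpM2r ?(ltW r0) // lerDl.
  by rewrite mulr_ge0 // ltW.
have gM2 : normalized v x <= 2 * M by lra.
rewrite ler_norml; apply/andP; split; last exact: bound.
by rewrite lerNl opprB; exact: bound.
Qed.

Lemma ler_root_diff (N : nat) (a b d : R) : (0 < N)%N ->
  0 <= a -> 0 <= b -> 0 <= d -> d <= a ->
  `|a - b| * d ^+ N.-1 <= `|a ^+ N - b ^+ N|.
Proof.
case: N => // N _ a0 b0 d0 da /=.
rewrite subrXX normrM ler_wpM2l //.
rewrite ger0_norm; last by apply: sumr_ge0 => i _; rewrite mulr_ge0 ?exprn_ge0.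
rewrite big_ord_recl /= subn0 expr0 mulr1.
apply: le_trans (_ : a ^+ N <= _); first by rewrite lerXn2r.
by rewrite lerDl; apply: sumr_ge0 => i _; rewrite mulr_ge0 ?exprn_ge0.
Qed.

Lemma grid_rate_gt0 (m M L : R) : 0 < m -> 0 < M -> 0 <= L ->
  0 < grid_rate m M L.
Proof.
move=> m0 M0 L0; have [C10 c00 lr0] := rate_signs m M L m0 M0 L0.
apply: mulr_gt0; first by rewrite mulr_gt0.
apply: ltr_wpDl; first by rewrite addr_ge0 ?ler0n.
by apply: mulr_gt0 => //; exact: divr_gt0.
Qed.

End FinalEstimates.

Theorem theorem1p1 (R : realType) (n : nat) (hn : (0 < n)%N) :
  exists C : R -> R -> R,
    forall f : 'rV[R]_n -> R,
      lipschitz_on_cube f ->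
      (forall x, cube x -> 0 < f x) ->
      let c := C (lipschitz_seminorm f) (inf (f @` cube)) in
      0 < c /\
      forall (h : R) (v u : 'rV[R]_n -> R),
        0 < h ->
        maximal_scheme_solution h f v ->
        viscosity_solution f u ->
        nondecreasing_on_cube u ->
        (forall x, (cube `&` grid h) x ->
           `|n%:R ^+ n * v x - u x ^+ n| <= c * Num.sqrt h) /\
        (forall (delta : R) x, 0 < delta -> (delta_cube delta `&` grid h) x ->
           `|n%:R * (v x `^ n%:R^-1) - u x|
             <= c * delta ^ (1 - n%:Z) * Num.sqrt h).
Proof.
pose rate (l m : R) := n%:R ^+ n * grid_rate (n := n) m (m + `|l| * n%:R) `|l|.
(* [low m * delta] is a lower bound for the [n]-th root of [n ^ n * v] on the
   cube of size [delta]: there [v >= m * vol >= m * delta ^ n]. *)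
pose low (m : R) := Num.min m 1.
exists (fun l m => rate l m * (1 + (low m ^+ n.-1)^-1)) => f Lf f0.
set l := lipschitz_seminorm f; set m := inf _ => c.
have [m0 mfM] := inf_cube_bounds f Lf f0; rewrite -/m -/l in m0 mfM.
have l0 : 0 <= `|l| by [].
have M0 : 0 < m + `|l| * n%:R by rewrite ltr_wpDr // mulr_ge0.
have n0 : 0 < n%:R :> R by rewrite ltr0n.
have rate0 : 0 < rate l m by rewrite mulr_gt0 ?exprn_gt0 // grid_rate_gt0.
have low0 : 0 < low m by rewrite lt_min m0 ltr01.
have lowV : 0 < (low m ^+ n.-1)^-1 by rewrite invr_gt0 exprn_gt0.
have rate_c : rate l m <= c by rewrite /c ler_peMr ?(ltW rate0) // lerDl ltW.
split; first by rewrite /c mulr_gt0 // addr_gt0.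
move=> h v u h0 sv vu _.
have sq0 : 0 <= Num.sqrt h := sqrtr_ge0 h.
have fL x y : cube x -> cube y -> `|f x - f y| <= `|l| * l1dist x y.
  by move=> cx cy; exact: lipschitz_l1.
have main x : (cube `&` grid h) x ->
    `|n%:R ^+ n * v x - u x ^+ n| <= rate l m * Num.sqrt h.
  move=> [cx gx]; have [Gx|px] := cube_Gamma_or_pos _ cx.
    have [_ uG _ _] := vu; rewrite sv.1 // uG // expr0n (gtn_eqF hn) /=.
    by rewrite mulr0 subrr normr0 mulr_ge0 // ltW.
  have -> : n%:R ^+ n * v x - u x ^+ n = n%:R ^+ n * (v x - (u x / n%:R) ^+ n).
    by rewrite mulrBr -exprMn mulrCA divff ?gt_eqF // mulr1.
  rewrite normrM ger0_norm ?exprn_ge0 // -mulrA ler_wpM2l ?exprn_ge0 //.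
  exact: (grid_error f).
split=> [x /main /le_trans|delta x d0 [dx gx]].
  by apply; rewrite ler_wpM2r.
have px : pos_cube x.
  by move=> i; have /andP[a ->] := dx i; rewrite andbT (lt_le_trans d0).
have Gx : pos_grid h x by [].
have cx := pos_cube_cube _ px.
have [ux _] := u_bounds hn f u m _ vu m0 mfM x px.
set a := n%:R * _.
have v0 := scheme_v_gt0 f v h hn h0 f0 sv x Gx.
have aX : a ^+ n = n%:R ^+ n * v x.
  rewrite exprMn -[X in _ * X = _]powR_mulrn ?powR_ge0 // -powRrM mulVf ?gt_eqF // powRr1 //.
  exact: ltW.
have a0 : 0 <= a by rewrite mulr_ge0 ?powR_ge0.
have ld0 : 0 < low m * delta by rewrite mulr_gt0.
have lda : low m * delta <= a.
  rewrite -(@ler_pXn2r _ n) ?nnegrE ?(ltW ld0) // aX exprMn.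
  have /andP[mv _] := normalized_bounds f v h hn h0 f0 sv m _ mfM x Gx.
  rewrite ler_pdivlMr ?vol_gt0 // in mv.
  have mdv : m * delta ^+ n <= v x.
    apply: le_trans mv; rewrite ler_wpM2l ?(ltW m0) //.
    rewrite -(iter_mulr_1 n delta) -big_const_ord.
    by apply: ler_prod => i _; rewrite (ltW d0); case/andP: (dx i).
  apply: le_trans (_ : m * delta ^+ n <= _).
    rewrite ler_wpM2r ?exprn_ge0 ?(ltW d0) //.
    apply: le_trans (_ : low m ^+ 1 <= _); last by rewrite expr1 ge_min lexx.
    by rewrite ler_wiXn2l // ?(ltW low0) // ge_min lexx orbT.
  apply: le_trans mdv _; rewrite ler_peMl ?(ltW v0) //.
  by rewrite exprn_ege1 // ler1n.
have := ler_root_diff n a (u x) _ hn a0 (ltW ux) (ltW ld0) lda.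
rewrite aX => /le_trans /(_ (main x (conj cx gx))).
have dE : delta ^ (1 - n%:Z) = (delta ^+ n.-1)^-1.
  rewrite -{1}(prednK hn) -addn1 PoszD opprD addrCA subrr addr0.
  by rewrite -exprnN.
rewrite -ler_pdivlMr ?exprn_gt0 // => /le_trans; apply.
rewrite dE exprMn invfM /c.
have dV : 0 < (delta ^+ n.-1)^-1 by rewrite invr_gt0 exprn_gt0.
rewrite [leLHS](_ : _ = rate l m * ((low m ^+ n.-1)^-1) *
   ((delta ^+ n.-1)^-1 * Num.sqrt h)); last by ring.
rewrite [leRHS](_ : _ = rate l m * (1 + (low m ^+ n.-1)^-1) *
   ((delta ^+ n.-1)^-1 * Num.sqrt h)); last by ring.
rewrite ler_wpM2r ?mulr_ge0 ?(ltW dV) //.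
by rewrite ler_wpM2l ?(ltW rate0) // lerDr.
Qed.
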